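(* For every finitely generated binary non-symmetric Koszul operad $\mathcal{P}$ and every $\mathcal{P}$-algebra $A$, the chain complex $C^\bullet_{\mathcal{P}}(A)$ defining the cohomology of $A$ is an operad with multiplication.
   Context: The ground field $k$ has characteristic $0$; $\mathcal{P}$ and $A$ are concentrated in degree $0$. A non-symmetric operad is an operad without symmetric group actions. A finitely generated binary Koszul non-symmetric operad is a quadratic operad $\mathcal{P}=\mathcal{F}(V)/(R)$ with $V$ a finite dimensional space in arity $2$, $R\subset\mathcal{F}(V)(3)$, such that the homology of the bar construction $\mathcal{B}(\mathcal{P})=\mathcal{F}^c(s\overline{\mathcal{P}})$ is concentrated in top dimension (in weight $\omega$, in degree $\omega$); this top homology is the Koszul dual cooperad $\mathcal{P}^{¡}$. Up to the usual operadic (de)suspension, $\mathcal{P}^{¡}(n)=\mathcal{P}^!(n)^*$ (placed in degree $n-1$), where $\mathcal{P}^!=\mathcal{F}(V^* )/(R^\perp)$ and the orthogonal is for the pairing with $\langle\mu\circ_1\nu,\zeta\circ_1\xi\rangle=\zeta(\mu)\xi(\nu)$, $\langle\mu\circ_2\nu,\zeta\circ_2\xi\rangle=-\zeta(\mu)\xi(\nu)$, others zero. $\mathrm{End}(A)(n)=\mathrm{Hom}_k(A^{\otimes n},A)$, and the $\mathcal{P}$-algebra structure is a morphism $\phi:\mathcal{P}\to\mathrm{End}(A)$. The complex is $C^\bullet_{\mathcal{P}}(A)=\mathrm{Hom}^\bullet_k(\mathcal{P}^{¡},\mathrm{End}(A))$, with arity $n$ component $\mathrm{Hom}_k(\mathcal{P}^{¡}(n),\mathrm{Hom}_k(A^{\otimes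 n},A))$. It is a non-symmetric operad (convolution operad): maps are composed by applying the cooperad decomposition of $\mathcal{P}^{¡}$, then the maps, then composition in $\mathrm{End}(A)$. With the preLie product $f\star g=\mu_{\mathrm{End}(A)}\circ(f\otimes g)\circ\Delta'$ ($\Delta'$ the partial coproduct of $\mathcal{P}^{¡}$) and $[f,g]=f\star g-(-1)^{|f||g|}g\star f$, its differential is $\partial(f)=[f,\alpha]$, where $\alpha:\mathcal{P}^{¡}\twoheadrightarrow\mathcal{P}^{¡}(2)=s\mathcal{P}(2)\to\mathcal{P}(2)\xrightarrow{\phi}\mathrm{End}(A)(2)$. An operad with multiplication is a non-symmetric operad $\mathcal{O}$ endowed with a morphism of operads $\mathcal{A}s\to\mathcal{O}$, where $\mathcal{A}s$ is the non-symmetric operad of (non-unital) associative algebras; here, as usual, this is understood up to operadic suspension (i.e. for the convolution operad $\mathrm{Hom}_k(\mathcal{P}^{!*},\mathrm{End}(A))$). *)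

(* Defs.v *)
From HB Require Import structures.
From mathcomp Require Import all_boot all_order all_algebra.
From mathcomp Require Import boolp functions.
From mathcomp Require Import finmap monalg zify ring.

Set Implicit Arguments.
Unset Strict Implicit.
Unset Printing Implicit Defensive.

Import GRing.Theory.
Local Open Scope ring_scope.

(* Partial compositions [f o_i g] are indexed from 0: [i : 'I_m].  The arity  *)
(* of the result is a parameter [p] with a proof of [(m + n).-1 = p], so that *)
(* the axioms need no casts.                                                  *)
Record operad (k : fieldType) (X : nat -> lmodType k) := Operad {
  op_id : X 1%N;
  op_comp : forall m n p, (m + n).-1 = p -> 'I_m -> X m -> X n -> X p;
  op_linl : forall m n p (e : (m + n).-1 = p) i g,
    linear (fun f => op_comp e i f g);
  op_linr : forall m n p (e : (m + n).-1 = p) i f, linear (op_comp e i f);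
  op_idl : forall n (e : (1 + n).-1 = n) i f, op_comp e i op_id f = f;
  op_idr : forall m (e : (m + 1).-1 = m) i f, op_comp e i f op_id = f;
  op_seq : forall m n l p q r (e1 : (m + n).-1 = p) (e2 : (p + l).-1 = r)
      (e3 : (n + l).-1 = q) (e4 : (m + q).-1 = r)
      (i : 'I_m) (j : 'I_n) (h : 'I_p) f g u,
    h = (i + j)%N :> nat ->
    op_comp e2 h (op_comp e1 i f g) u = op_comp e4 i f (op_comp e3 j g u);
  op_par : forall m n l p q r (e1 : (m + n).-1 = p) (e2 : (p + l).-1 = r)
      (e3 : (m + l).-1 = q) (e4 : (q + n).-1 = r)
      (i j : 'I_m) (i' : 'I_q) (j' : 'I_p) f g u,
    (i < j)%N -> i' = i :> nat -> j'.+1 = (j + n)%N :> nat ->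
    op_comp e2 j' (op_comp e1 i f g) u = op_comp e4 i' (op_comp e3 j f u) g
}.

Record operad_mor (k : fieldType) (X Y : nat -> lmodType k)
    (O : operad X) (O' : operad Y) := OperadMor {
  mor_fun :> forall n, X n -> Y n;
  mor_linear : forall n, linear (@mor_fun n);
  mor_id : mor_fun (op_id O) = op_id O';
  mor_comp : forall m n p (e : (m + n).-1 = p) i f g,
    mor_fun (op_comp O e i f g) = op_comp O' e i (mor_fun f) (mor_fun g)
}.

Record set_operad (T : nat -> finType) := SetOperad {
  so_id : T 1%N;
  so_comp : forall m n p, (m + n).-1 = p -> 'I_m -> T m -> T n -> T p;
  so_idl : forall n (e : (1 + n).-1 = n) i a, so_comp e i so_id a = a;
  so_idr : forall m (e : (m + 1).-1 = m) i a, so_comp e i a so_id = a;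
  so_seq : forall m n l p q r (e1 : (m + n).-1 = p) (e2 : (p + l).-1 = r)
      (e3 : (n + l).-1 = q) (e4 : (m + q).-1 = r)
      (i : 'I_m) (j : 'I_n) (h : 'I_p) a b c,
    h = (i + j)%N :> nat ->
    so_comp e2 h (so_comp e1 i a b) c = so_comp e4 i a (so_comp e3 j b c);
  so_par : forall m n l p q r (e1 : (m + n).-1 = p) (e2 : (p + l).-1 = r)
      (e3 : (m + l).-1 = q) (e4 : (q + n).-1 = r)
      (i j : 'I_m) (i' : 'I_q) (j' : 'I_p) a b c,
    (i < j)%N -> i' = i :> nat -> j'.+1 = (j + n)%N :> nat ->
    so_comp e2 j' (so_comp e1 i a b) c = so_comp e4 i' (so_comp e3 j a c) b
}.

Section Linearisation.
Variable k : fieldType.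

Definition free_vect (T : finType) : vectType k := {ffun T -> k^o}.

Definition delta (T : finType) (a : T) : free_vect T :=
  [ffun t => (t == a)%:R].

Lemma free_vect_sum (T : finType) (f : free_vect T) :
  f = \sum_a (f a : k) *: delta a.
Proof.
apply/ffunP => t; rewrite sum_ffunE (bigD1 t) //= !ffunE eqxx /GRing.scale /= mulr1.
rewrite big1 ?addr0 // => a /negbTE neq.
by rewrite !ffunE eq_sym neq /GRing.scale /= mulr0.
Qed.

Lemma lin_sumZ (U W : lmodType k) (F : U -> W) (I : finType)
    (c : I -> k) (x : I -> U) : linear F ->
  F (\sum_i c i *: x i) = \sum_i c i *: F (x i).
Proof.
move=> linF.
pose F' := HB.pack_for {linear U -> W} F (GRing.isLinear.Build _ _ _ _ F linF).
by rewrite -[F]/(F' : U -> W) linear_sum; apply: eq_bigr => i _; rewrite linearZ.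
Qed.

Lemma free_vect_ext (T : finType) (W : lmodType k) (F G : free_vect T -> W) :
  linear F -> linear G -> (forall a, F (delta a) = G (delta a)) ->
  forall f, F f = G f.
Proof.
move=> linF linG FG f; rewrite (free_vect_sum f) !lin_sumZ //.
by apply: eq_bigr => a _; rewrite FG.
Qed.

Lemma lin_scale (U W : lmodType k) (F : U -> W) c x :
  linear F -> F (c *: x) = c *: F x.
Proof. by move=> /(lin_sumZ (I := 'I_1) (fun=> c) (fun=> x)); rewrite !big_ord1. Qed.

Lemma op_comp_suml (X : nat -> lmodType k) (O : operad X) m n p
    (e : (m + n).-1 = p) i g (I : finType) (c : I -> k) (x : I -> X m) :
  op_comp O e i (\sum_j c j *: x j) g = \sum_j c j *: op_comp O e i (x j) g.
Proof. by rewrite (@lin_sumZ _ _ (fun f => op_comp O e i f g)) //; apply: op_linl. Qed.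

Lemma op_comp_sumr (X : nat -> lmodType k) (O : operad X) m n p
    (e : (m + n).-1 = p) i f (I : finType) (c : I -> k) (x : I -> X n) :
  op_comp O e i f (\sum_j c j *: x j) = \sum_j c j *: op_comp O e i f (x j).
Proof. by rewrite (@lin_sumZ _ _ (op_comp O e i f)) //; apply: op_linr. Qed.

Lemma linear_comp (U U' W : lmodType k) (F : U' -> W) (G : U -> U') :
  linear F -> linear G -> linear (fun x => F (G x)).
Proof. by move=> linF linG a x y; rewrite linG linF. Qed.

Variables (T : nat -> finType) (S : set_operad T).

Definition lin_comp m n p (e : (m + n).-1 = p) (i : 'I_m)
    (f : free_vect (T m)) (g : free_vect (T n)) : free_vect (T p) :=
  \sum_a \sum_b (f a * g b : k) *: delta (so_comp S e i a b).

Fact lin_comp_linl m n p (e : (m + n).-1 = p) i g :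
  linear (fun f => lin_comp e i f g).
Proof.
move=> c f f'; rewrite /lin_comp scaler_sumr -big_split; apply: eq_bigr => a _ /=.
rewrite scaler_sumr -big_split; apply: eq_bigr => b _ /=.
by rewrite !ffunE scalerA -scalerDl mulrDl mulrA.
Qed.

Fact lin_comp_linr m n p (e : (m + n).-1 = p) i f : linear (lin_comp e i f).
Proof.
move=> c g g'; rewrite /lin_comp scaler_sumr -big_split; apply: eq_bigr => a _ /=.
rewrite scaler_sumr -big_split; apply: eq_bigr => b _ /=.
by rewrite !ffunE scalerA -scalerDl mulrDr mulrCA.
Qed.

Lemma lin_comp_delta m n p (e : (m + n).-1 = p) i a b :
  lin_comp e i (delta a) (delta b) = delta (so_comp S e i a b).
Proof.
rewrite /lin_comp (bigD1 a) //= (bigD1 b) //= !ffunE !eqxx mulr1 scale1r.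
rewrite big1 ?addr0 => [|b' /negbTE nb]; last first.
  by rewrite !ffunE nb mulr0 scale0r.
rewrite big1 ?addr0 // => a' /negbTE na; rewrite big1 // => b' _.
by rewrite !ffunE na mul0r scale0r.
Qed.

Fact lin_idl n (e : (1 + n).-1 = n) i f : lin_comp e i (delta (so_id S)) f = f.
Proof.
move: f; apply: free_vect_ext => [||a]; first exact: lin_comp_linr.
  by move=> c x y.
by rewrite lin_comp_delta so_idl.
Qed.

Fact lin_idr m (e : (m + 1).-1 = m) i f : lin_comp e i f (delta (so_id S)) = f.
Proof.
move: f; apply: free_vect_ext => [||a]; first exact: lin_comp_linl.
  by move=> c x y.
by rewrite lin_comp_delta so_idr.
Qed.

Fact lin_seq m n l p q r (e1 : (m + n).-1 = p) (e2 : (p + l).-1 = r)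
    (e3 : (n + l).-1 = q) (e4 : (m + q).-1 = r)
    (i : 'I_m) (j : 'I_n) (h : 'I_p) f g u :
  h = (i + j)%N :> nat ->
  lin_comp e2 h (lin_comp e1 i f g) u = lin_comp e4 i f (lin_comp e3 j g u).
Proof.
move=> hij; move: u; apply: free_vect_ext => [||c].
- exact: lin_comp_linr.
- by apply: linear_comp; exact: lin_comp_linr.
move: g; apply: free_vect_ext => [||b].
- apply: (linear_comp (F := fun x => lin_comp e2 h x (delta c))).
    exact: lin_comp_linl.
  exact: lin_comp_linr.
- by apply: linear_comp; [exact: lin_comp_linr | exact: lin_comp_linl].
move: f; apply: free_vect_ext => [||a].
- apply: (linear_comp (F := fun x => lin_comp e2 h x (delta c))).
    exact: lin_comp_linl.
  exact: lin_comp_linl.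
- exact: lin_comp_linl.
by rewrite !lin_comp_delta (so_seq S e1 e2 e3 e4 _ _ _ hij).
Qed.

Fact lin_par m n l p q r (e1 : (m + n).-1 = p) (e2 : (p + l).-1 = r)
    (e3 : (m + l).-1 = q) (e4 : (q + n).-1 = r)
    (i j : 'I_m) (i' : 'I_q) (j' : 'I_p) f g u :
  (i < j)%N -> i' = i :> nat -> j'.+1 = (j + n)%N :> nat ->
  lin_comp e2 j' (lin_comp e1 i f g) u = lin_comp e4 i' (lin_comp e3 j f u) g.
Proof.
move=> ij ii' jj'; move: u; apply: free_vect_ext => [||c].
- exact: lin_comp_linr.
- apply: (linear_comp (F := fun x => lin_comp e4 i' x g)).
    exact: lin_comp_linl.
  exact: lin_comp_linr.
move: g; apply: free_vect_ext => [||b].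
- apply: (linear_comp (F := fun x => lin_comp e2 j' x (delta c))).
    exact: lin_comp_linl.
  exact: lin_comp_linr.
- exact: lin_comp_linr.
move: f; apply: free_vect_ext => [||a].
- apply: (linear_comp (F := fun x => lin_comp e2 j' x (delta c))).
    exact: lin_comp_linl.
  exact: lin_comp_linl.
- apply: (linear_comp (F := fun x => lin_comp e4 i' x (delta b))).
    exact: lin_comp_linl.
  exact: lin_comp_linl.
by rewrite !lin_comp_delta (so_par S e1 e2 e3 e4 _ _ _ ij ii' jj').
Qed.

Definition lin_operad : operad (fun n => free_vect (T n)) :=
  Operad lin_comp_linl lin_comp_linr lin_idl lin_idr lin_seq lin_par.

End Linearisation.

(* Non-unital associative algebras: one operation in each positive arity,     *)
(* none in arity 0.                                                           *)
Definition as_set (n : nat) : finType := 'I_(0 < n)%N.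

Fact as_comp_subproof m n p : (m + n).-1 = p -> as_set m -> as_set n ->
  (0 < (0 < p))%N.
Proof.
case: m => [|m] e [a ha] // [b hb]; case: n e hb => // n <- _.
by rewrite addnS.
Qed.

Definition as_comp m n p (e : (m + n).-1 = p) (i : 'I_m)
    (a : as_set m) (b : as_set n) : as_set p :=
  Ordinal (as_comp_subproof e a b).

Lemma as_set_eq n (a b : as_set n) : a = b.
Proof. by apply: val_inj; case: a b => [[|a] ha] [[|b] hb] //=; case: (n) ha hb. Qed.

Definition as_set_operad : set_operad as_set.
Proof.
by exists (@ord0 0) as_comp => *; apply: as_set_eq.
Defined.

Definition as_car (k : fieldType) (n : nat) : vectType k :=
  free_vect k (as_set n).

Definition as_operad (k : fieldType) : operad (as_car k) :=
  lin_operad k as_set_operad.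

Definition as_mu (k : fieldType) : as_car k 2 := delta k (@ord0 0 : as_set 2).

Section BinaryTrees.
Variable S : finType.

Inductive bintree := Leaf | Node of S & bintree & bintree.

Fixpoint leaves t := if t is Node _ l r then (leaves l + leaves r)%N else 1%N.

Fixpoint graft t (i : nat) s :=
  match t with
  | Leaf => s
  | Node a l r => if (i < leaves l)%N then Node a (graft l i s) r
                  else Node a l (graft r (i - leaves l) s)
  end.

Lemma leaves_gt0 t : (0 < leaves t)%N.
Proof. by elim: t => //= a l IHl r IHr; rewrite addn_gt0 IHl. Qed.

Lemma leaves_graft t i s : (i < leaves t)%N ->
  leaves (graft t i s) = (leaves t + leaves s).-1.
Proof.
elim: t i => [|a l IHl r IHr] i //= ilt.
have l0 := leaves_gt0 l; have r0 := leaves_gt0 r.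
by case: (ltnP i) => il /=; [rewrite IHl // | rewrite IHr]; lia.
Qed.

Lemma graftr0 t i : graft t i Leaf = t.
Proof.
by elim: t i => //= a l IHl r IHr i; case: ifP => _; rewrite ?IHl ?IHr.
Qed.

Lemma graft_seq t s u i j : (i < leaves t)%N -> (j < leaves s)%N ->
  graft (graft t i s) (i + j) u = graft t i (graft s j u).
Proof.
elim: t i => [|a l IHl r IHr] i /=; first by case: i.
move=> ilt js; case: (ltnP i) => il /=.
  rewrite leaves_graft // IHl //.
  by have -> : (i + j < (leaves l + leaves s).-1)%N by lia.
rewrite ltnNge (_ : (leaves l <= i + j)%N) /=; last lia.
by rewrite -addnBAC // IHr //; lia.
Qed.

Lemma graft_par t s u i j j' : (i < j)%N -> (j < leaves t)%N ->
  j'.+1 = (j + leaves s)%N ->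
  graft (graft t i s) j' u = graft (graft t j u) i s.
Proof.
elim: t i j j' => [|a l IHl r IHr] i j j' /=; first by lia.
move=> ij jt jj'; have lt0 := leaves_gt0 l; have st0 := leaves_gt0 s.
case: (ltnP j) => jl.
  rewrite (ltn_trans ij jl) /= !leaves_graft //; last lia.
  have ut0 := leaves_gt0 u.
  have -> : (j' < (leaves l + leaves s).-1)%N by lia.
  have -> : (i < (leaves l + leaves u).-1)%N by lia.
  by rewrite (IHl i j j').
case: (ltnP i) => il /=.
  rewrite leaves_graft // il ltnNge (_ : (_ <= j')%N) /=; last lia.
  by congr (Node _ _ (graft _ _ _)); lia.
rewrite (ltnNge i) il (ltnNge j') (_ : (_ <= j')%N) /=; last lia.
by congr (Node _ _ _); apply: IHr; lia.
Qed.

Fixpoint polish t : seq (option S) :=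
  if t is Node a l r then Some a :: polish l ++ polish r else [:: None].

Lemma polish_inj_cat t t' w w' :
  polish t ++ w = polish t' ++ w' -> t = t' /\ w = w'.
Proof.
elim: t t' w w' => [|a l IHl r IHr] [|a' l' r'] w w' //=; first by case.
case=> ->; rewrite -!catA => /IHl[-> /IHr[-> ->]].
by [].
Qed.

Lemma polish_inj : injective polish.
Proof.
move=> t t' eq_tt'; have [] // := @polish_inj_cat t t' [::] [::].
by rewrite eq_tt'.
Qed.

Lemma size_polish t : size (polish t) = (leaves t).*2.-1.
Proof.
elim: t => //= a l IHl r IHr; rewrite size_cat IHl IHr.
by have := leaves_gt0 l; have := leaves_gt0 r; lia.
Qed.

Definition ntree (n : nat) := {t : bintree | leaves t == n}.

Definition ntree_code n (t : ntree n) : n.*2.-1.-tuple (option S).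
Proof.
exists (polish (val t)); apply/eqP; rewrite size_polish.
by rewrite (eqP (valP t)).
Defined.

Lemma ntree_code_inj n : injective (@ntree_code n).
Proof. by move=> t t' [/polish_inj/val_inj]. Qed.

Definition ntree_decode n (w : n.*2.-1.-tuple (option S)) : option (ntree n) :=
  if pselect (exists t : ntree n, ntree_code t = w) is left h
  then Some (projT1 (cid h)) else None.

Lemma ntree_codeK n : pcancel (@ntree_code n) (@ntree_decode n).
Proof.
move=> t; rewrite /ntree_decode; case: pselect => [h|[]]; last by exists t.
by case: cid => t' /= /ntree_code_inj ->.
Qed.

HB.instance Definition _ n := Finite.copy (ntree n) (pcan_type (@ntree_codeK n)).

Fact graft_subproof m n p (e : (m + n).-1 = p) (i : 'I_m)
    (t : ntree m) (s : ntree n) : leaves (graft (val t) i (val s)) == p.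
Proof. by rewrite leaves_graft (eqP (valP t)) // (eqP (valP s)) e. Qed.

Definition ngraft m n p (e : (m + n).-1 = p) (i : 'I_m)
    (t : ntree m) (s : ntree n) : ntree p :=
  exist _ (graft (val t) i (val s)) (graft_subproof e i t s).

Definition nleaf : ntree 1 := exist _ Leaf (eqxx 1%N).

Definition corolla (a : S) : ntree 2 := exist _ (Node a Leaf Leaf) (eqxx 2%N).

Definition tree_operad : set_operad ntree.
Proof.
exists nleaf ngraft => [n e i a|m e i a|m n l p q r e1 e2 e3 e4 i j h a b c hij
  |m n l p q r e1 e2 e3 e4 i j i' j' a b c ij ii' jj']; apply: val_inj => //=.
- exact: graftr0.
- by rewrite hij graft_seq ?(eqP (valP a)) ?(eqP (valP b)).
- rewrite ii'; apply: (graft_par _ ij); first by rewrite (eqP (valP a)).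
  by rewrite (eqP (valP b)).
Defined.

End BinaryTrees.

Section FreeOperad.
Variables (k : fieldType) (V : vectType k).

(* The free operad F(V) on V placed in arity 2: its arity n component has as  *)
(* basis the planar binary trees with n leaves and internal vertices labelled *)
(* by the elements of a basis of V.                                           *)
Definition gen_lab : finType := 'I_(\dim {:V}).

Definition gen_vect (a : gen_lab) : V := (vbasis {:V})`_a.

Definition free_car (n : nat) : vectType k := free_vect k (ntree gen_lab n).

Definition free_operad : operad free_car := lin_operad k (tree_operad gen_lab).

Definition free_gen (v : V) : free_car 2 :=
  \sum_(a : gen_lab) coord (vbasis {:V}) a v *: delta k (corolla a).

End FreeOperad.

Section VspaceOf.
Variables (k : fieldType) (U : vectType k).

Definition lin_closed (D : U -> Prop) :=
  D 0 /\ forall a x y, D x -> D y -> D (a *: x + y).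

Lemma ex_vspace_of (D : U -> Prop) : lin_closed D ->
  exists W : {vspace U}, forall x, x \in W <-> D x.
Proof.
move=> [D0 DL].
pose Q n := `[< exists W : {vspace U}, (forall x, x \in W -> D x) /\ \dim W = n >].
have exQ : exists n, Q n.
  exists 0%N; apply/asboolP; exists 0%VS; split; last exact: dimv0.
  by move=> x; rewrite memv0 => /eqP->.
have leQ n : Q n -> (n <= \dim {:U})%N.
  by move=> /asboolP[W [_ <-]]; apply: dimvS; apply: subvf.
case: (ex_maxnP exQ leQ) => n /asboolP[W [WD dimW]] maxn.
exists W => x; split; first exact: WD.
move=> Dx; apply/negPn/negP => xW.
have : Q (\dim (W + <[x]>)%VS).
  apply/asboolP; exists (W + <[x]>)%VS; split => //.
  move=> _ /memv_addP[w Ww [_ /vlineP[c ->] ->]].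
  by rewrite addrC; apply: DL => //; apply: WD.
move/maxn; rewrite -dimW leqNgt => /negP[].
rewrite ltn_neqAle dimvS ?addvSl // andbT; apply/negP => eqd.
have /eqP eqW : (W == W + <[x]>)%VS by rewrite eqEdim addvSl (eqP eqd) /=.
by case/negP: xW; rewrite eqW; apply: (subvP (addvSr W _)); apply: memv_line.
Qed.

(* The subspace of all x satisfying D, for D closed under linear combinations *)
Definition vspace_of (D : U -> Prop) : {vspace U} :=
  if pselect (exists W : {vspace U}, forall x, x \in W <-> D x) is left h
  then projT1 (cid h) else 0%VS.

Lemma mem_vspace_of (D : U -> Prop) : lin_closed D ->
  forall x, x \in vspace_of D <-> D x.
Proof.
move=> /ex_vspace_of exW; rewrite /vspace_of; case: pselect => // h.
by case: cid.
Qed.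

End VspaceOf.

Section Quotient.
Variables (k : fieldType) (X : nat -> vectType k) (O : operad X).

Definition op_ideal (D : forall n, X n -> Prop) :=
  [/\ forall n, lin_closed (@D n),
      forall m n p (e : (m + n).-1 = p) i f g,
        D m f -> D p (op_comp O e i f g)
    & forall m n p (e : (m + n).-1 = p) i f g,
        D n g -> D p (op_comp O e i f g)].

Variables (r : nat) (R : {vspace X r}).

Definition gen_ideal n (x : X n) : Prop :=
  forall D, op_ideal D -> (forall y, y \in R -> D r y) -> D n x.

Lemma gen_ideal_ideal : op_ideal gen_ideal.
Proof.
split=> [n|m n p e i f g fI D ID RD|m n p e i f g gI D ID RD].
- split=> [D [/(_ n)[]] //|a x y xI yI D ID RD].
  have [/(_ n)[_ DL] _ _] := ID; apply: DL; [exact: xI | exact: yI].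
- by case: (ID) => _ Dl _; apply: Dl; apply: fI.
- by case: (ID) => _ _ Dr; apply: Dr; apply: gI.
Qed.

Definition ideal n : {vspace X n} := vspace_of (@gen_ideal n).

Lemma mem_ideal n x : x \in ideal n <-> gen_ideal x.
Proof. by apply: mem_vspace_of; case: gen_ideal_ideal. Qed.

(* X n / ideal n is carried by a complement of ideal n, with quotient map     *)
(* quot_proj and linear section vsval.                                        *)
Definition quot_car (n : nat) : vectType k := subvs_of (ideal n)^C.

Definition quot_proj n (x : X n) : quot_car n :=
  vsproj (ideal n)^C (daddv_pi (ideal n)^C (ideal n) x).

Fact quot_proj_linear n : linear (@quot_proj n).
Proof. by move=> a x y; rewrite /quot_proj !linearP. Qed.
HB.instance Definition _ n :=
  GRing.isLinear.Build _ _ _ _ (@quot_proj n) (@quot_proj_linear n).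

Lemma quot_capv n : ((ideal n)^C :&: ideal n)%VS = 0%VS.
Proof. by rewrite capvC capv_compl. Qed.

Lemma quot_projE n x :
  vsval (@quot_proj n x) = daddv_pi (ideal n)^C (ideal n) x.
Proof. by rewrite vsprojK // memv_pi. Qed.

Lemma quot_proj_val n (x : quot_car n) : quot_proj (vsval x) = x.
Proof.
by apply: val_inj; rewrite /= quot_projE daddv_pi_id ?quot_capv ?subvsP.
Qed.

Lemma quot_val_proj n (x : X n) : x - vsval (quot_proj x) \in ideal n.
Proof.
rewrite quot_projE.
rewrite -[X in X - _](@daddv_pi_add _ _ (ideal n)^C (ideal n)) ?quot_capv //.
  by rewrite addrAC subrr add0r memv_pi.
by rewrite addvC addv_complf memvf.
Qed.

Lemma quot_proj_eq0 n (x : X n) : (quot_proj x == 0) = (x \in ideal n).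
Proof.
apply/eqP/idP => [x0|xI].
  by have := quot_val_proj x; rewrite x0 [vsval 0]linear0 subr0.
apply: val_inj; apply/eqP; rewrite [val 0]linear0 -memv0 -(quot_capv n).
rewrite memv_cap subvsP.
by have := quot_val_proj x => /(memvB xI); rewrite subKr.
Qed.

Definition quot_comp m n p (e : (m + n).-1 = p) (i : 'I_m)
    (x : quot_car m) (y : quot_car n) : quot_car p :=
  quot_proj (op_comp O e i (vsval x) (vsval y)).

Lemma quot_proj_comp m n p (e : (m + n).-1 = p) i x y :
  quot_comp e i (quot_proj x) (quot_proj y) = quot_proj (op_comp O e i x y).
Proof.
have [_ Il Ir] := gen_ideal_ideal.
apply/eqP; rewrite /quot_comp eq_sym -subr_eq0 -linearB quot_proj_eq0.
set x' := vsval _; set y' := vsval _.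
have -> : op_comp O e i x y - op_comp O e i x' y' =
    op_comp O e i (x - x') y + op_comp O e i x' (y - y').
  have Bl a b c : op_comp O e i (a - b) c = op_comp O e i a c - op_comp O e i b c.
    by rewrite addrC -scaleN1r (op_linl O) scaleN1r addrC.
  have Br a b c : op_comp O e i c (a - b) = op_comp O e i c a - op_comp O e i c b.
    by rewrite addrC -scaleN1r (op_linr O) scaleN1r addrC.
  by rewrite Bl Br addrA subrK.
apply: memvD; apply/mem_ideal.
  by apply: Il; apply/mem_ideal; apply: quot_val_proj.
by apply: Ir; apply/mem_ideal; apply: quot_val_proj.
Qed.

Fact quot_linl m n p (e : (m + n).-1 = p) i y :
  linear (fun x => quot_comp e i x y).
Proof. by move=> a x x'; rewrite /quot_comp linearP (op_linl O) linearP. Qed.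

Fact quot_linr m n p (e : (m + n).-1 = p) i x : linear (quot_comp e i x).
Proof. by move=> a y y'; rewrite /quot_comp linearP (op_linr O) linearP. Qed.

Fact quot_idl n (e : (1 + n).-1 = n) i x :
  quot_comp e i (quot_proj (op_id O)) x = x.
Proof.
by rewrite -[x in LHS]quot_proj_val quot_proj_comp (op_idl O) quot_proj_val.
Qed.

Fact quot_idr m (e : (m + 1).-1 = m) i x :
  quot_comp e i x (quot_proj (op_id O)) = x.
Proof.
by rewrite -[x in LHS]quot_proj_val quot_proj_comp (op_idr O) quot_proj_val.
Qed.

Fact quot_seq m n l p q s (e1 : (m + n).-1 = p) (e2 : (p + l).-1 = s)
    (e3 : (n + l).-1 = q) (e4 : (m + q).-1 = s)
    (i : 'I_m) (j : 'I_n) (h : 'I_p) f g u :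
  h = (i + j)%N :> nat ->
  quot_comp e2 h (quot_comp e1 i f g) u = quot_comp e4 i f (quot_comp e3 j g u).
Proof.
move=> hij; rewrite -(quot_proj_val f) -(quot_proj_val g) -(quot_proj_val u).
by rewrite !quot_proj_comp (op_seq O e1 e2 e3 e4 _ _ _ hij).
Qed.

Fact quot_par m n l p q s (e1 : (m + n).-1 = p) (e2 : (p + l).-1 = s)
    (e3 : (m + l).-1 = q) (e4 : (q + n).-1 = s)
    (i j : 'I_m) (i' : 'I_q) (j' : 'I_p) f g u :
  (i < j)%N -> i' = i :> nat -> j'.+1 = (j + n)%N :> nat ->
  quot_comp e2 j' (quot_comp e1 i f g) u =
  quot_comp e4 i' (quot_comp e3 j f u) g.
Proof.
move=> ij ii' jj'.
rewrite -(quot_proj_val f) -(quot_proj_val g) -(quot_proj_val u).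
by rewrite !quot_proj_comp (op_par O e1 e2 e3 e4 _ _ _ ij ii' jj').
Qed.

Definition quot_operad : operad quot_car :=
  Operad quot_linl quot_linr quot_idl quot_idr quot_seq quot_par.

End Quotient.

Section Quadratic.
Variables (k : fieldType) (V : vectType k) (R : {vspace free_car V 3}).

Definition quad_car (n : nat) : vectType k := quot_car (free_operad V) R n.

Definition quad_operad : operad quad_car := quot_operad (free_operad V) R.

Definition quad_gen (v : V) : quad_car 2 :=
  quot_proj (free_operad V) R (free_gen v).

End Quadratic.

Section KoszulDualOperad.
Variables (k : fieldType) (V : vectType k).

Definition dual (U : vectType k) : vectType k := 'Hom(U, k^o).

Definition lab_pairing (a : gen_lab V) (b : gen_lab (dual V)) : k :=
  gen_vect b (gen_vect a).

(* [Node a (Node b Leaf Leaf) Leaf] is a o_1 b, [Node a Leaf (Node b Leaf     *)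
(* Leaf)] is a o_2 b (1-based indices).                                       *)
Definition tree_pairing (s : bintree (gen_lab V)) (t : bintree (gen_lab (dual V)))
    : k :=
  match s, t with
  | Node a (Node b Leaf Leaf) Leaf, Node a' (Node b' Leaf Leaf) Leaf =>
      lab_pairing a a' * lab_pairing b b'
  | Node a Leaf (Node b Leaf Leaf), Node a' Leaf (Node b' Leaf Leaf) =>
      - (lab_pairing a a' * lab_pairing b b')
  | _, _ => 0
  end.

Definition pairing (x : free_car V 3) (y : free_car (dual V) 3) : k :=
  \sum_s \sum_t (x s : k) * (y t : k) * tree_pairing (val s) (val t).

Definition orth (R : {vspace free_car V 3}) : {vspace free_car (dual V) 3} :=
  vspace_of (fun y => forall x, x \in R -> pairing x y = 0).

Lemma mem_orth R y : y \in orth R <-> forall x, x \in R -> pairing x y = 0.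
Proof.
apply: mem_vspace_of; split=> [x _|a y1 y2 y10 y20 x xR].
  by rewrite /pairing big1 // => s _; rewrite big1 // => t _; rewrite ffunE mulr0 mul0r.
rewrite -[RHS](mulr0 a) -[RHS]addr0 -[X in _ = _ + X](y20 x xR) -[X in _ = a * X + _](y10 x xR).
rewrite /pairing mulr_sumr -big_split; apply: eq_bigr => s _ /=.
rewrite mulr_sumr -big_split; apply: eq_bigr => t _ /=.
by rewrite !ffunE /GRing.scale /= mulrDr mulrDl mulrCA !mulrA.
Qed.

End KoszulDualOperad.

Section PairingFormula.
Variables (k : fieldType) (V : vectType k).

Local Notation gen_comp i u v := (@op_comp _ _ (free_operad _) 2 2 3 (erefl 3)
  (i : 'I_2) (free_gen u) (free_gen v)).

Lemma free_gen_comp (W : vectType k) (i : 'I_2) (u v : W) :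
  gen_comp i u v = \sum_(a : gen_lab W) \sum_(b : gen_lab W)
    (coord (vbasis {:W}) a u * coord (vbasis {:W}) b v) *:
    delta k (@ngraft _ 2 2 3 (erefl 3) i (corolla a) (corolla b)).
Proof.
rewrite /free_gen op_comp_suml; apply: eq_bigr => a _.
rewrite op_comp_sumr scaler_sumr; apply: eq_bigr => b _.
by rewrite scalerA /= lin_comp_delta.
Qed.

Lemma pairing_delta s t :
  pairing (delta k s) (delta k t) = tree_pairing (V := V) (val s) (val t).
Proof.
rewrite /pairing (bigD1 s) //= (bigD1 t) //= !ffunE !eqxx !mul1r.
rewrite big1 ?addr0 => [|t' /negbTE nt]; last by rewrite !ffunE nt mulr0 mul0r.
rewrite big1 ?addr0 // => s' /negbTE ns; rewrite big1 // => t' _.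
by rewrite !ffunE ns !mul0r.
Qed.

Lemma pairing_linl y : linear (fun x : free_car V 3 => pairing x y : k^o).
Proof.
move=> a x x'; rewrite /pairing scaler_sumr -big_split; apply: eq_bigr => s _ /=.
rewrite scaler_sumr -big_split; apply: eq_bigr => t _ /=.
by rewrite !ffunE /GRing.scale /= !mulrDl !mulrA.
Qed.

Lemma pairing_linr x : linear (fun y => pairing (V := V) x y : k^o).
Proof.
move=> a y y'; rewrite /pairing scaler_sumr -big_split; apply: eq_bigr => s _ /=.
rewrite scaler_sumr -big_split; apply: eq_bigr => t _ /=.
by rewrite !ffunE /GRing.scale /= mulrDr mulrDl mulrCA !mulrA.
Qed.

Lemma pairing_suml (I : finType) (c : I -> k) x y :
  pairing (\sum_j c j *: x j) y = \sum_j c j * pairing (V := V) (x j) y.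
Proof. exact: (lin_sumZ c x (pairing_linl y)). Qed.

Lemma pairing_sumr (I : finType) (c : I -> k) x y :
  pairing x (\sum_j c j *: y j) = \sum_j c j * pairing (V := V) x (y j).
Proof. exact: (lin_sumZ c y (pairing_linr x)). Qed.

Lemma lab_pairing_sum (mu : V) (zeta : dual V) :
  \sum_a \sum_b coord (vbasis {:V}) a mu * coord (vbasis {:dual V}) b zeta *
    lab_pairing a b = zeta mu.
Proof.
rewrite [in RHS](coord_vbasis (memvf mu)) linear_sum; apply: eq_bigr => a _.
rewrite linearZ /= [in RHS](coord_vbasis (memvf zeta)).
rewrite (@lin_sumZ _ _ _ (fun z : dual V => z (gen_vect a))); last first.
  by move=> c x y; rewrite add_lfunE scale_lfunE.
rewrite scaler_sumr; apply: eq_bigr => b _.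
by rewrite -mulrA.
Qed.

Lemma pairingE (i j : 'I_2) (mu nu : V) (zeta xi : dual V) :
  pairing (gen_comp i mu nu) (gen_comp j zeta xi) =
  if i == j then (-1) ^+ i * (zeta mu * xi nu) else 0.
Proof.
have tp a b a' b' : tree_pairing
    (val (@ngraft _ 2 2 3 (erefl 3) i (corolla a) (corolla b)))
    (val (@ngraft _ 2 2 3 (erefl 3) j (corolla a') (corolla b'))) =
    (i == j)%:R * (-1) ^+ i * (lab_pairing a a' * lab_pairing (V := V) b b').
  case: i => [[|[|i]] hi] //; case: j => [[|[|j]] hj] //=;
    by rewrite !(expr0, expr1, mul1r, mul0r, mulN1r).
have -> : (if i == j then (-1) ^+ i * (zeta mu * xi nu) else 0) =
    (i == j)%:R * (-1) ^+ i * (zeta mu * xi nu).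
  by case: eqP; rewrite ?mul1r ?mul0r.
rewrite !free_gen_comp -!lab_pairing_sum !pair_bigA /=.
rewrite pairing_suml.
transitivity (\sum_(p : gen_lab V * gen_lab V)
  \sum_(q : gen_lab (dual V) * gen_lab (dual V))
    coord (vbasis {:V}) p.1 mu * coord (vbasis {:V}) p.2 nu *
    (coord (vbasis {:dual V}) q.1 zeta * coord (vbasis {:dual V}) q.2 xi *
    ((i == j)%:R * (-1) ^+ i * (lab_pairing p.1 q.1 * lab_pairing p.2 q.2)))).
  apply: eq_bigr => p _; rewrite -mulr_sumr; congr (_ * _).
  rewrite pairing_sumr.
  by apply: eq_bigr => q _; rewrite pairing_delta tp.
rewrite -(pair_bigA _ (fun a b => \sum_(q : gen_lab (dual V) * gen_lab (dual V))
    coord (vbasis {:V}) a mu * coord (vbasis {:V}) b nu *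
    (coord (vbasis {:dual V}) q.1 zeta * coord (vbasis {:dual V}) q.2 xi *
    ((i == j)%:R * (-1) ^+ i * (lab_pairing a q.1 * lab_pairing b q.2))))) /=.
rewrite -(pair_bigA _ (fun a b => coord (vbasis {:V}) a mu *
    coord (vbasis {:dual V}) b zeta * lab_pairing a b)) /=.
rewrite mulr_suml mulr_sumr; apply: eq_bigr => a _.
rewrite -(pair_bigA _ (fun a b => coord (vbasis {:V}) a nu *
    coord (vbasis {:dual V}) b xi * lab_pairing a b)) /= mulr_sumr mulr_sumr.
apply: eq_bigr => b _.
rewrite -(pair_bigA _ (fun a' b' => 
    coord (vbasis {:V}) a mu * coord (vbasis {:V}) b nu *
    (coord (vbasis {:dual V}) a' zeta * coord (vbasis {:dual V}) b' xi *
    ((i == j)%:R * (-1) ^+ i * (lab_pairing a a' * lab_pairing b b'))))) /=.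
rewrite mulr_suml mulr_sumr; apply: eq_bigr => a' _.
rewrite mulr_sumr mulr_sumr; apply: eq_bigr => b' _.
ring.
Qed.

End PairingFormula.

Section Bar.
Variables (k : fieldType) (X : nat -> vectType k) (O : operad X).

(* Planar trees whose vertices with m inputs carry a basis vector of X m.     *)
(* Those satisfying [btree_wf] (every vertex has as many children as its      *)
(* label has inputs, and at least two) form a basis of the cofree cooperad    *)
(* F^c(s Pbar) on Pbar = (X m)_(m >= 2).  Each vertex s p has degree 1; such  *)
(* a tree stands for the tensor of its vertices in depth-first, left-to-right *)
(* order (each vertex preceding its descendants).                             *)
Inductive btree :=
  BLeaf | BNode (m : nat) of 'I_(\dim {:X m}) & seq btree.

HB.instance Definition _ := gen_eqMixin btree.
HB.instance Definition _ := gen_choiceMixin btree.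

Fixpoint btree_wf (t : btree) : bool :=
  if t is BNode m _ ts then [&& (1 < m)%N, size ts == m & all btree_wf ts]
  else true.

Fixpoint btree_arity (t : btree) : nat :=
  if t is BNode _ _ ts then sumn (map btree_arity ts) else 1%N.

Fixpoint btree_degree (t : btree) : nat :=
  if t is BNode _ _ ts then (sumn (map btree_degree ts)).+1 else 0%N.

(* Contraction of the edge from the root, with label a and children           *)
(* [pre ++ u :: post], to the root of its child u.                            *)
Definition contract m (a : 'I_(\dim {:X m})) (pre : seq btree) (u : btree)
    (post : seq btree) : {malg k[btree]} :=
  match u, (insub (size pre) : option 'I_m) with
  | BNode n b us, Some i =>
      \sum_(c < \dim {:X (m + n).-1})
        << coord (vbasis {:X (m + n).-1}) c
             (op_comp O erefl i (vbasis {:X m})`_a (vbasis {:X n})`_b)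
           *g BNode c (pre ++ us ++ post) >>
  | _, _ => 0
  end.

Definition malg_ext (F : btree -> {malg k[btree]}) (c : {malg k[btree]}) :
    {malg k[btree]} :=
  \sum_(t <- msupp c) c@_t *: F t.

(* The differential is the sum, over the internal edges, of the contractions  *)
(* of the edge (parent p, child q), replacing s p and s q by s (p o_i q), with*)
(* the sign (-1)^(j-1) for j the position (from 0) of the child vertex in the *)
(* above order: the Koszul sign of a degree -1 map applied at the parent once *)
(* s q has been moved next to s p, up to a sign common to all the edges.      *)
Fixpoint bar_diff_tree (t : btree) : {malg k[btree]} :=
  if t is BNode m a ts then
    (fix go (pre : seq btree) (ts : seq btree) : {malg k[btree]} :=
       if ts is u :: post then
         (-1) ^+ sumn (map btree_degree pre) *:
           (contract a pre u post -
            malg_ext (fun u' => << BNode a (pre ++ u' :: post) >>)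
                     (bar_diff_tree u))
         + go (rcons pre u) post
       else 0) [::] ts
  else 0.

Definition bar_diff (c : {malg k[btree]}) : {malg k[btree]} :=
  malg_ext bar_diff_tree c.

Definition bar_chain (n d : nat) (c : {malg k[btree]}) : Prop :=
  forall t, t \in msupp c ->
    [/\ btree_wf t, btree_arity t = n & btree_degree t = d].

(* Koszulness of an operad presented by binary generators: its arity n        *)
(* component has weight n - 1, so the homology of the bar construction in     *)
(* arity n must be concentrated in degree n - 1.                              *)
Definition binary_koszul : Prop :=
  forall n d c, d <> n.-1 -> bar_chain n d c -> bar_diff c = 0 ->
    exists b, bar_chain n d.+1 b /\ bar_diff b = c.

End Bar.

Section Endomorphisms.
Variables (k : fieldType) (A : lmodType k).

Definition upd n (x : 'I_n -> A) (i : 'I_n) (a : A) : 'I_n -> A :=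
  fun j => if j == i then a else x j.

Definition multilinear n (f : ('I_n -> A) -> A) : Prop :=
  forall x i, linear (fun a => f (upd x i a)).

Definition multi_pred n : {pred ('I_n -> A) -> A} :=
  fun f => `[< multilinear f >].

Fact multi_submod_closed n : submod_closed (@multi_pred n).
Proof.
split=> [|a f g /asboolP fm /asboolP gm]; apply/asboolP => x i c u v.
  by rewrite /= scaler0 addr0.
have -> w : (a *: f + g) (upd x i w) = a *: f (upd x i w) + g (upd x i w) by [].
by rewrite fm gm !scalerDr !scalerA [a * c]mulrC -!addrA; congr (_ + _); rewrite addrCA.
Qed.
HB.instance Definition _ n :=
  GRing.isSubmodClosed.Build k (('I_n -> A) -> A) (@multi_pred n)
    (@multi_submod_closed n).

(* Hom_k(A^{(x) n}, A), as multilinear maps on families of n vectors          *)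
Definition end_car (n : nat) := {f : ('I_n -> A) -> A | f \in @multi_pred n}.
HB.instance Definition _ n := SubChoice.on (end_car n).
HB.instance Definition _ n :=
  [SubChoice_isSubLmodule of end_car n by <:].

Lemma end_multilinear n (f : end_car n) : multilinear (val f).
Proof. exact/asboolP/(valP f). Qed.

Lemma end_eq n (f g : end_car n) : (forall x, val f x = val g x) -> f = g.
Proof. by move=> fg; apply: val_inj; apply/funext. Qed.

(* A family indexed by 'I_n, extended by 0 to nat                             *)
Definition ext n (x : 'I_n -> A) (j : nat) : A :=
  if insub j is Some j' then x j' else 0.

Lemma ext_lt n (x : nat -> A) j : (j < n)%N -> ext (fun l : 'I_n => x l) j = x j.
Proof. by move=> jn; rewrite /ext insubT. Qed.

Lemma ext_ord n (x : 'I_n -> A) (j : 'I_n) : ext x j = x j.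
Proof. by rewrite /ext valK. Qed.

Lemma ext_upd n (x : 'I_n -> A) h a j :
  ext (upd x h a) j = if j == h :> nat then a else ext x j.
Proof.
rewrite /ext /upd; case: insubP => [j' _ <- //|jn].
by case: eqP => // jh; move: jn; rewrite jh ltn_ord.
Qed.

(* (f o_i g)(x_0, .., x_(m+n-2)) =                                            *)
(*   f(x_0, .., x_(i-1), g(x_i, .., x_(i+n-1)), x_(i+n), .., x_(m+n-2))       *)
Definition end_args m n (i : 'I_m) (g : ('I_n -> A) -> A) (x : nat -> A) :
    'I_m -> A :=
  fun j => if (j < i)%N then x j
           else if j == i then g (fun l => x (i + l)%N)
           else x (j + n).-1.

Definition end_fun m n p (i : 'I_m) (f : ('I_m -> A) -> A)
    (g : ('I_n -> A) -> A) : ('I_p -> A) -> A :=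
  fun x => f (end_args i g (ext x)).

Fact end_fun_multi m n p (e : (m + n).-1 = p) i f g :
  multilinear f -> multilinear g -> multilinear (@end_fun m n p i f g).
Proof.
move=> fm gm x h c u v; rewrite /end_fun; have hp := ltn_ord h.
have im := ltn_ord i.
have [hi|ih] := ltnP h i.
  have hm : (h < m)%N := ltn_trans hi im.
  suff E a : end_args i g (ext (upd x h a)) =
      upd (end_args i g (ext x)) (Ordinal hm) a by rewrite !E fm.
  apply/funext => j; rewrite /end_args /upd -!val_eqE /= -/(upd x h a).
  have [ji|ij|ji] := ltngtP j i.
  - by rewrite ext_upd.
  - rewrite ext_upd; have -> : ((j + n).-1 == h :> nat) = false by lia.
    by have -> : (j == h :> nat) = false by lia.
  - have -> : (j == h :> nat) = false by lia.
    congr g; apply/funext => l; rewrite ext_upd.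
    by have -> : (i + l == h :> nat)%N = false by lia.
have [hin|inh] := ltnP h (i + n).
  have hn : (h - i < n)%N by lia.
  suff E a : end_args i g (ext (upd x h a)) = upd (end_args i g (ext x)) i
      (g (upd (fun l : 'I_n => ext x (i + l)) (Ordinal hn) a)).
    by rewrite !E gm fm.
  apply/funext => j; rewrite /end_args /upd -!val_eqE /= -/(upd x h a).
  have [ji|ij|ji] := ltngtP j i.
  - rewrite ext_upd; by have -> : (j == h :> nat) = false by lia.
  - rewrite ext_upd; by have -> : ((j + n).-1 == h :> nat) = false by lia.
  - congr g; apply/funext => l; rewrite ext_upd -val_eqE /=.
    by have -> : (i + l == h :> nat)%N = (l == h - i :> nat)%N by lia.
have hm : ((h - n).+1 < m)%N by lia.
suff E a : end_args i g (ext (upd x h a)) =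
    upd (end_args i g (ext x)) (Ordinal hm) a by rewrite !E fm.
apply/funext => j; rewrite /end_args /upd -!val_eqE /= -/(upd x h a).
have [ji|ij|ji] := ltngtP j i.
- rewrite ext_upd; have -> : (j == h :> nat) = false by lia.
  by have -> : (j == (h - n).+1 :> nat) = false by lia.
- rewrite ext_upd.
  by have -> : ((j + n).-1 == h :> nat) = (j == (h - n).+1 :> nat) by lia.
- have -> : (j == (h - n).+1 :> nat) = false by lia.
  congr g; apply/funext => l; rewrite ext_upd.
  have ln := ltn_ord l; by have -> : (i + l == h :> nat)%N = false by lia.
Qed.

Definition end_comp m n p (e : (m + n).-1 = p) (i : 'I_m)
    (f : end_car m) (g : end_car n) : end_car p :=
  exist _ (end_fun i (val f) (val g))
    (asboolT (end_fun_multi e i (end_multilinear f) (end_multilinear g))).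

Definition end_id : end_car 1.
Proof.
exists (fun x => x ord0); apply/asboolP => x i c u v.
by rewrite /upd (ord1 i) eqxx.
Defined.

Fact end_linl m n p (e : (m + n).-1 = p) i g :
  linear (fun f => end_comp e i f g).
Proof. by move=> c f f'; apply: end_eq. Qed.

Fact end_linr m n p (e : (m + n).-1 = p) i f : linear (end_comp e i f).
Proof.
move=> c g g'; apply: end_eq => x /=.
have E (g0 : end_car n) : end_args i (val g0) (ext x) =
    upd (end_args i (val g) (ext x)) i (val g0 (fun l => ext x (i + l))).
  apply/funext => j; rewrite /end_args /upd -!val_eqE /=.
  by case: (ltngtP j i).
by rewrite /end_fun (E (c *: g + g')) (end_multilinear f) -!E.
Qed.

Fact end_idl n (e : (1 + n).-1 = n) i f : end_comp e i end_id f = f.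
Proof.
apply: end_eq => x /=; rewrite /end_fun /end_args (ord1 i) /=.
by congr (val f _); apply/funext => l; rewrite add0n ext_ord.
Qed.

Fact end_idr m (e : (m + 1).-1 = m) i f : end_comp e i f end_id = f.
Proof.
apply: end_eq => x /=; rewrite /end_fun /end_args; congr (val f _).
apply/funext => j; rewrite addn1 /= ext_ord addn0.
by case: ltnP => // _; case: eqP => // ->; rewrite ext_ord.
Qed.

Fact end_seq m n l p q r (e1 : (m + n).-1 = p) (e2 : (p + l).-1 = r)
    (e3 : (n + l).-1 = q) (e4 : (m + q).-1 = r)
    (i : 'I_m) (j : 'I_n) (h : 'I_p) f g u :
  h = (i + j)%N :> nat ->
  end_comp e2 h (end_comp e1 i f g) u = end_comp e4 i f (end_comp e3 j g u).
Proof.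
move=> hij; apply: end_eq => x /=; rewrite /end_fun; congr (val f _).
have im := ltn_ord i; have jn := ltn_ord j.
apply/funext => a; rewrite /end_args -!val_eqE /=; have am := ltn_ord a.
have extE b : (b < p)%N ->
  ext (fun j0 : 'I_p => if (j0 < h)%N then ext x j0 else
    if j0 == h then val u (fun l0 : 'I_l => ext x (h + l0)) else
    ext x (j0 + l).-1) b =
  if (b < h)%N then ext x b else if b == h :> nat then
    val u (fun l0 : 'I_l => ext x (h + l0)) else ext x (b + l).-1.
  by move=> bp; rewrite /ext insubT.
have [ai|ia|ai] := ltngtP a i.
- by rewrite extE; [have -> : (a < h)%N by lia | lia].
- rewrite extE; last lia.
  have -> : ((a + n).-1 < h)%N = false by lia.
  have -> : ((a + n).-1 == h :> nat) = false by lia.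
  by congr (ext x _); lia.
congr (val g _); apply/funext => b; have bn := ltn_ord b.
rewrite extE; last lia.
rewrite /= /end_args -!val_eqE /=.
have [bj|jb|bj] := ltngtP b j.
- have -> : (i + b < h)%N by lia.
  by rewrite (@ext_lt _ (fun c => ext x (i + c))) //; lia.
- have -> : (i + b < h)%N = false by lia.
  have -> : (i + b == h :> nat)%N = false by lia.
  by rewrite (@ext_lt _ (fun c => ext x (i + c))); [congr (ext x _); lia | lia].
- have -> : (i + b < h)%N = false by lia.
  have -> : (i + b == h :> nat)%N by lia.
  congr (val u _); apply/funext => d; have dl := ltn_ord d.
  by rewrite (@ext_lt _ (fun c => ext x (i + c))); [congr (ext x _); lia | lia].
Qed.

Fact end_par m n l p q r (e1 : (m + n).-1 = p) (e2 : (p + l).-1 = r)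
    (e3 : (m + l).-1 = q) (e4 : (q + n).-1 = r)
    (i j : 'I_m) (i' : 'I_q) (j' : 'I_p) f g u :
  (i < j)%N -> i' = i :> nat -> j'.+1 = (j + n)%N :> nat ->
  end_comp e2 j' (end_comp e1 i f g) u = end_comp e4 i' (end_comp e3 j f u) g.
Proof.
move=> ij ii' jj'; apply: end_eq => x /=; rewrite /end_fun; congr (val f _).
have im := ltn_ord i; have jm := ltn_ord j.
apply/funext => a; rewrite /end_args -!val_eqE /=; have am := ltn_ord a.
have extE s (h : 'I_s) t (v : ('I_t -> A) -> A) b : (b < s)%N ->
  ext (fun j0 : 'I_s => if (j0 < h)%N then ext x j0 else
    if j0 == h then v (fun l0 : 'I_t => ext x (h + l0)) else
    ext x (j0 + t).-1) b =
  if (b < h)%N then ext x b else if b == h :> nat then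
    v (fun l0 : 'I_t => ext x (h + l0)) else ext x (b + t).-1.
  by move=> bs; rewrite /ext insubT.
have [ai|ia|ai] := ltngtP a i.
- have -> : (a < j)%N by lia.
  rewrite !extE; [|lia|lia].
  by have [-> ->] : (a < j')%N /\ (a < i')%N by lia.
- have [aj|ja|aj] := ltngtP a j.
  + rewrite !extE; [|lia|lia].
    have -> : ((a + n).-1 < j')%N by lia.
    have -> : (a < i')%N = false by lia.
    by have -> : (a == i' :> nat) = false by lia.
  + rewrite !extE; [|lia|lia].
    have -> : ((a + n).-1 < j')%N = false by lia.
    have -> : ((a + n).-1 == j' :> nat) = false by lia.
    have -> : ((a + l).-1 < i')%N = false by lia.
    have -> : ((a + l).-1 == i' :> nat) = false by lia.
    by congr (ext x _); lia.
  + rewrite extE; last lia.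
    have -> : ((a + n).-1 < j')%N = false by lia.
    have -> : ((a + n).-1 == j' :> nat) by lia.
    congr (val u _); apply/funext => d; have dl := ltn_ord d.
    rewrite extE; last lia.
    have -> : (j + d < i')%N = false by lia.
    have -> : (j + d == i' :> nat)%N = false by lia.
    by congr (ext x _); lia.
have -> : (a < j)%N by lia.
rewrite [RHS]extE; last lia.
have -> : (a < i')%N = false by lia.
have -> : (a == i' :> nat) by lia.
congr (val g _); apply/funext => d; have dn := ltn_ord d.
rewrite extE; last lia.
have -> : (i + d < j')%N by lia.
by rewrite ii'.
Qed.

Definition end_operad : operad end_car :=
  Operad end_linl end_linr end_idl end_idr end_seq end_par.

End Endomorphisms.

Section LinearMaps.
Variables (k : fieldType) (U W : lmodType k).

Definition linmap_pred : {pred U -> W} := fun f => `[< linear f >].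

Fact linmap_submod_closed : submod_closed linmap_pred.
Proof.
split=> [|a f g /asboolP fl /asboolP gl]; apply/asboolP => c u v.
  by rewrite /= scaler0 addr0.
have -> w : (a *: f + g) w = a *: f w + g w by [].
by rewrite fl gl !scalerDr !scalerA [a * c]mulrC -!addrA; congr (_ + _); rewrite addrCA.
Qed.
HB.instance Definition _ :=
  GRing.isSubmodClosed.Build k (U -> W) linmap_pred linmap_submod_closed.

Definition linmap := {f : U -> W | f \in linmap_pred}.
HB.instance Definition _ := SubChoice.on linmap.
HB.instance Definition _ := [SubChoice_isSubLmodule of linmap by <:].

Lemma linmap_linear (f : linmap) : linear (val f).
Proof. exact/asboolP/(valP f). Qed.

Lemma linmapE (c : k) (f g : linmap) x :
  val (c *: f + g) x = c *: val f x + val g x.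
Proof. by []. Qed.

Lemma linmap_eq (f g : linmap) : (forall x, val f x = val g x) -> f = g.
Proof. by move=> fg; apply: val_inj; apply/funext. Qed.

Definition mk_linmap (f : U -> W) (fl : linear f) : linmap :=
  exist _ f (asboolT fl).

End LinearMaps.

(* The convolution operad Hom_k(Q^*, E), for Q with finite dimensional        *)
(* components.                                                                *)
Section Convolution.
Variables (k : fieldType) (X : nat -> vectType k) (Y : nat -> lmodType k).
Variables (Q : operad X) (E : operad Y).

Definition dual_vect (U : vectType k) (a : 'I_(\dim {:U})) : dual U :=
  linfun (coord (vbasis {:U}) a : U -> k^o).

Definition conv_car (n : nat) : lmodType k := linmap (dual (X n)) (Y n).

(* The partial decomposition of x in Q(p)^* is                                *)
(*   sum_(a, b) x(e_a o_i e_b) e_a^* (x) e_b^*                                *)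
(* for bases (e_a) of Q(m) and (e_b) of Q(n).                                 *)
Definition conv_fun m n p (e : (m + n).-1 = p) (i : 'I_m)
    (f : conv_car m) (g : conv_car n) (x : dual (X p)) : Y p :=
  \sum_(a < \dim {:X m}) \sum_(b < \dim {:X n})
    (x (op_comp Q e i (vbasis {:X m})`_a (vbasis {:X n})`_b) : k) *:
      op_comp E e i (val f (dual_vect a)) (val g (dual_vect b)).

Fact conv_fun_linear m n p (e : (m + n).-1 = p) i f g :
  linear (conv_fun e i f g).
Proof.
move=> c x y; rewrite /conv_fun scaler_sumr -big_split; apply: eq_bigr => a _ /=.
rewrite scaler_sumr -big_split; apply: eq_bigr => b _ /=.
by rewrite add_lfunE scale_lfunE scalerA -scalerDl.
Qed.

Definition conv_comp m n p (e : (m + n).-1 = p) (i : 'I_m)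
    (f : conv_car m) (g : conv_car n) : conv_car p :=
  mk_linmap (conv_fun_linear e i f g).

Lemma conv_compE m n p (e : (m + n).-1 = p) i f g x :
  val (conv_comp e i f g) x = conv_fun e i f g x.
Proof. by []. Qed.

Fact conv_id_linear : linear (fun x : dual (X 1) => (x (op_id Q) : k) *: op_id E).
Proof.
by move=> c x y; rewrite add_lfunE scale_lfunE scalerA -scalerDl.
Qed.

Definition conv_id : conv_car 1 := mk_linmap conv_id_linear.

Fact conv_linl m n p (e : (m + n).-1 = p) i g :
  linear (fun f => conv_comp e i f g).
Proof.
move=> c f f'; apply: linmap_eq => x.
rewrite linmapE /= /conv_fun scaler_sumr -big_split.
apply: eq_bigr => a _ /=; rewrite scaler_sumr -big_split; apply: eq_bigr => b _ /=.
by rewrite (op_linl E) scalerDr !scalerA [c * _]mulrC.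
Qed.

Fact conv_linr m n p (e : (m + n).-1 = p) i f : linear (conv_comp e i f).
Proof.
move=> c g g'; apply: linmap_eq => x.
rewrite linmapE /= /conv_fun scaler_sumr -big_split.
apply: eq_bigr => a _ /=; rewrite scaler_sumr -big_split; apply: eq_bigr => b _ /=.
by rewrite (op_linr E) scalerDr !scalerA [c * _]mulrC.
Qed.

Lemma dual_vectE (U : vectType k) (a : 'I_(\dim {:U})) v :
  dual_vect a v = coord (vbasis {:U}) a v.
Proof. by rewrite lfunE. Qed.

Lemma dual_sum (U : vectType k) (x : dual U) :
  x = \sum_(a < \dim {:U}) (x (vbasis {:U})`_a : k) *: dual_vect a.
Proof.
apply/lfunP => v; rewrite (@lin_sumZ _ _ _ (fun z : dual U => z v)); last first.
  by move=> c y z; rewrite add_lfunE scale_lfunE.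
rewrite [v in LHS](coord_vbasis (memvf v)) linear_sum; apply: eq_bigr => a _.
by rewrite linearZ /= dual_vectE /GRing.scale /= mulrC.
Qed.

Lemma linmap_sum (U V : lmodType k) (f : linmap U V) (I : finType) c (x : I -> U) :
  val f (\sum_j c j *: x j) = \sum_j c j *: val f (x j).
Proof. by rewrite lin_sumZ //; apply: linmap_linear. Qed.

Fact conv_idl n (e : (1 + n).-1 = n) i f : conv_comp e i conv_id f = f.
Proof.
apply: linmap_eq => x; rewrite [in RHS](dual_sum x) linmap_sum /= /conv_fun.
rewrite exchange_big; apply: eq_bigr => b _ /=.
under eq_bigr => a _ do rewrite (lin_scale _ _ (op_linl _ _ _ _)) (op_idl E) scalerA.
rewrite -scaler_suml; congr (_ *: _).
rewrite -[in RHS](op_idl Q e i (_`_b)) [in RHS](coord_vbasis (memvf (op_id Q))).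
rewrite op_comp_suml linear_sum; apply: eq_bigr => a _.
by rewrite dual_vectE linearZ /GRing.scale /= mulrC.
Qed.

Fact conv_idr m (e : (m + 1).-1 = m) i f : conv_comp e i f conv_id = f.
Proof.
apply: linmap_eq => x; rewrite [in RHS](dual_sum x) linmap_sum /= /conv_fun.
apply: eq_bigr => a _ /=.
under eq_bigr => b _ do rewrite (lin_scale _ _ (op_linr _ _ _ _)) (op_idr E) scalerA.
rewrite -scaler_suml; congr (_ *: _).
rewrite -[in RHS](op_idr Q e i (_`_a)) [in RHS](coord_vbasis (memvf (op_id Q))).
rewrite op_comp_sumr linear_sum; apply: eq_bigr => b _.
by rewrite dual_vectE linearZ /GRing.scale /= mulrC.
Qed.

Lemma conv_compl m n l p r (e1 : (m + n).-1 = p) (e2 : (p + l).-1 = r)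
    (i : 'I_m) (h : 'I_p) f g u x :
  val (conv_comp e2 h (conv_comp e1 i f g) u) x =
  \sum_(c < \dim {:X m}) \sum_(d < \dim {:X n}) \sum_(b < \dim {:X l})
    (x (op_comp Q e2 h (op_comp Q e1 i (vbasis {:X m})`_c (vbasis {:X n})`_d)
         (vbasis {:X l})`_b) : k) *:
    op_comp E e2 h (op_comp E e1 i (val f (dual_vect c)) (val g (dual_vect d)))
      (val u (dual_vect b)).
Proof.
rewrite [RHS]pair_bigA conv_compE /conv_fun.
transitivity (\sum_(a < \dim {:X p})
  \sum_(cd : 'I_(\dim {:X m}) * 'I_(\dim {:X n})) \sum_(b < \dim {:X l})
  ((x (op_comp Q e2 h (vbasis {:X p})`_a (vbasis {:X l})`_b) : k) *
   coord (vbasis {:X p}) a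
     (op_comp Q e1 i (vbasis {:X m})`_cd.1 (vbasis {:X n})`_cd.2)) *:
    op_comp E e2 h (op_comp E e1 i (val f (dual_vect cd.1))
      (val g (dual_vect cd.2))) (val u (dual_vect b))).
  apply: eq_bigr => a _; rewrite [RHS]exchange_big; apply: eq_bigr => b _.
  rewrite conv_compE /conv_fun pair_bigA op_comp_suml scaler_sumr; apply: eq_bigr => cd _.
  by rewrite scalerA dual_vectE.
rewrite exchange_big; apply: eq_bigr => cd _.
rewrite exchange_big; apply: eq_bigr => b _.
rewrite -scaler_suml; congr (_ *: _).
set v := op_comp Q e1 i _ _.
rewrite [v in RHS](coord_vbasis (memvf v)) op_comp_suml linear_sum.
by apply: eq_bigr => a _; rewrite linearZ /GRing.scale /= mulrC.
Qed.

Lemma conv_compr m n l q r (e3 : (n + l).-1 = q) (e4 : (m + q).-1 = r)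
    (i : 'I_m) (j : 'I_n) f g u x :
  val (conv_comp e4 i f (conv_comp e3 j g u)) x =
  \sum_(c < \dim {:X m}) \sum_(d < \dim {:X n}) \sum_(b < \dim {:X l})
    (x (op_comp Q e4 i (vbasis {:X m})`_c
         (op_comp Q e3 j (vbasis {:X n})`_d (vbasis {:X l})`_b)) : k) *:
    op_comp E e4 i (val f (dual_vect c))
      (op_comp E e3 j (val g (dual_vect d)) (val u (dual_vect b))).
Proof.
rewrite conv_compE /conv_fun; apply: eq_bigr => c _; rewrite [RHS]pair_bigA.
transitivity (\sum_(a < \dim {:X q}) \sum_(db : 'I_(\dim {:X n}) * 'I_(\dim {:X l}))
  ((x (op_comp Q e4 i (vbasis {:X m})`_c (vbasis {:X q})`_a) : k) *
   coord (vbasis {:X q}) a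
     (op_comp Q e3 j (vbasis {:X n})`_db.1 (vbasis {:X l})`_db.2)) *:
    op_comp E e4 i (val f (dual_vect c)) (op_comp E e3 j
      (val g (dual_vect db.1)) (val u (dual_vect db.2)))).
  apply: eq_bigr => a _.
  rewrite conv_compE /conv_fun pair_bigA op_comp_sumr scaler_sumr; apply: eq_bigr => db _.
  by rewrite scalerA dual_vectE.
rewrite exchange_big; apply: eq_bigr => db _.
rewrite -scaler_suml; congr (_ *: _).
set v := op_comp Q e3 j _ _.
rewrite [v in RHS](coord_vbasis (memvf v)) op_comp_sumr linear_sum.
by apply: eq_bigr => a _; rewrite linearZ /GRing.scale /= mulrC.
Qed.

Fact conv_seq m n l p q r (e1 : (m + n).-1 = p) (e2 : (p + l).-1 = r)
    (e3 : (n + l).-1 = q) (e4 : (m + q).-1 = r)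
    (i : 'I_m) (j : 'I_n) (h : 'I_p) f g u :
  h = (i + j)%N :> nat ->
  conv_comp e2 h (conv_comp e1 i f g) u = conv_comp e4 i f (conv_comp e3 j g u).
Proof.
move=> hij; apply: linmap_eq => x; rewrite conv_compl conv_compr.
apply: eq_bigr => c _; apply: eq_bigr => d _; apply: eq_bigr => b _.
by rewrite (op_seq Q e1 e2 e3 e4 _ _ _ hij) (op_seq E e1 e2 e3 e4 _ _ _ hij).
Qed.

Fact conv_par m n l p q r (e1 : (m + n).-1 = p) (e2 : (p + l).-1 = r)
    (e3 : (m + l).-1 = q) (e4 : (q + n).-1 = r)
    (i j : 'I_m) (i' : 'I_q) (j' : 'I_p) f g u :
  (i < j)%N -> i' = i :> nat -> j'.+1 = (j + n)%N :> nat ->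
  conv_comp e2 j' (conv_comp e1 i f g) u =
  conv_comp e4 i' (conv_comp e3 j f u) g.
Proof.
move=> ij ii' jj'; apply: linmap_eq => x; rewrite !conv_compl.
apply: eq_bigr => c _; rewrite exchange_big.
apply: eq_bigr => b _; apply: eq_bigr => d _.
by rewrite (op_par Q e1 e2 e3 e4 _ _ _ ij ii' jj')
           (op_par E e1 e2 e3 e4 _ _ _ ij ii' jj').
Qed.

Definition conv_operad : operad conv_car :=
  Operad conv_linl conv_linr conv_idl conv_idr conv_seq conv_par.

End Convolution.

Section Bracket.
Variables (k : fieldType) (Y : nat -> lmodType k) (O : operad Y).

(* PreLie product and bracket of the operadic suspension of O: an element of  *)
(* Y n has degree n - 1, and f o_i g acquires the sign (-1)^(i (n - 1)), i    *)
(* counted from 0.  [n.+1] is used for n - 1 in the exponents of -1.          *)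
Definition prelie m n p (e : (m + n).-1 = p) (f : Y m) (g : Y n) : Y p :=
  \sum_(i < m) (-1) ^+ (i * n.+1) *: op_comp O e i f g.

Definition bracket m n p (e : (m + n).-1 = p) (e' : (n + m).-1 = p)
    (f : Y m) (g : Y n) : Y p :=
  prelie e f g - (-1) ^+ (m.+1 * n.+1) *: prelie e' g f.

(* [f, mu] for mu in arity 2                                                  *)
Definition bracket_diff (mu : Y 2) (n : nat) (f : Y n) : Y n.+1 :=
  bracket (congr1 predn (addn2 n)) (erefl : (2 + n).-1 = n.+1) f mu.

Definition multiplication := operad_mor (as_operad k) O.

Definition mult_diff (M : multiplication) : forall n, Y n -> Y n.+1 :=
  bracket_diff (M 2 (as_mu k)).

End Bracket.

Section Cohomology.
Variables (k : fieldType) (V : vectType k) (R : {vspace free_car V 3}).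
Variables (A : lmodType k).

Definition koszul_dual_car : nat -> vectType k := quad_car (orth R).

Definition koszul_dual_operad : operad koszul_dual_car := quad_operad (orth R).

(* The Koszul dual cooperad is the linear dual of P^! up to operadic          *)
(* suspension; the suspension is accounted for by the signs and the degree    *)
(* n - 1 in [prelie] and [bracket].                                           *)
Definition cochain (n : nat) : lmodType k :=
  conv_car koszul_dual_car (end_car A) n.

Definition cochain_operad : operad cochain :=
  conv_operad koszul_dual_operad (end_operad A).

Variable phi : operad_mor (quad_operad R) (end_operad A).

(* alpha on P^!(2)^* = V^** = V = P(2), the vector of V corresponding to x    *)
(* being sum_a x(e_a^* ) e_a.                                                 *)
Definition alpha_fun (x : dual (koszul_dual_car 2)) : end_car A 2 :=
  phi 2 (quad_gen R (\sum_(a < \dim {:V})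
    (x (quad_gen (orth R) (dual_vect a)) : k) *: (vbasis {:V})`_a)).

Fact alpha_linear : linear alpha_fun.
Proof.
have gl : linear (quad_gen R).
  move=> c u v; rewrite /quad_gen -linearP; congr (quot_proj _ _ _).
  rewrite /free_gen scaler_sumr -big_split; apply: eq_bigr => a _ /=.
  by rewrite linearP scalerDl scalerA.
move=> c x y; rewrite /alpha_fun -(mor_linear phi) -gl; congr (phi 2 (quad_gen _ _)).
rewrite scaler_sumr -big_split; apply: eq_bigr => a _ /=.
by rewrite add_lfunE scale_lfunE scalerDl scalerA.
Qed.

Definition alpha : cochain 2 := mk_linmap alpha_linear.

Definition cohom_diff : forall n, cochain n -> cochain n.+1 :=
  bracket_diff cochain_operad alpha.

End Cohomology.

(* Main.v *)
Require Import Defs.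
From mathcomp Require Import all_boot all_order all_algebra.
From mathcomp Require Import zify.

(** The degree two cochain [alpha] is itself the multiplication.

    An operation [mu] in O(2) with mu o_0 mu = mu o_1 mu is the same thing as
    a morphism from the operad of associative algebras to [O]: the generator
    of arity n goes to the left comb mu(... mu(mu(x, x), x) ..., x) on n
    inputs ([comb_comp]).  The bracket with such a [mu] is then, up to a
    global sign, the Hochschild differential: the alternating sum of the
    cofaces mu o_1 f, f o_i mu, mu o_0 f ([bracket_diffE]).  The cosimplicial
    identities between them ([coface_coface]) make it square to zero
    ([bracket_diff_square]).

    It remains to see that [alpha] is associative in the convolution operad
    ([alpha_associative]).  Write e_a for a basis of V and e^a for the dual
    basis.  As an element of P^!(2) (x) End(A)(2), [alpha] is the sum over a
    of e^a (x) phi(e_a), so that alpha o_i alpha is the sum over a and b of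
    (e^a o_i e^b) (x) phi(e_a o_i e_b).  Hence alpha o_0 alpha - alpha o_1 alpha
    is the image of the sum of (-1)^i (e^a o_i e^b) (x) (e_a o_i e_b), the
    canonical element of F(V^dual)(3) (x) F(V)(3) for the pairing that defines
    the orthogonal of R; the sign in that pairing is the sign of this
    difference.  Applying to the left factor a linear form that vanishes on
    the orthogonal of R gives an element of the double orthogonal of R, which
    is R ([orth_orth]), and phi vanishes on R. *)

Set Implicit Arguments.
Unset Strict Implicit.
Unset Printing Implicit Defensive.

Import GRing.Theory.
Local Open Scope ring_scope.

(** * Alternating sums of cosimplicial type *)

(** The usual cancellation: the terms with i < j are matched with the opposite
    terms with j <= i by sending (j, i) to (i, j - 1). *)
Lemma cosimplicial_sum0 (k : fieldType) (W : lmodType k) N (a : nat -> nat -> W) :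
  (forall i j, (i < j)%N -> (j <= N)%N -> a j i = a i j.-1) ->
  \sum_(j < N.+1) \sum_(i < N) (-1) ^+ (i + j) *: a j i = 0.
Proof.
move=> aS.
have split_sum (j : nat) : \sum_(i < N) (-1) ^+ (i + j) *: a j i =
    \sum_(i < N | (i < j)%N) (-1) ^+ (i + j) *: a j i +
    \sum_(i < N | (j <= i)%N) (-1) ^+ (i + j) *: a j i.
  rewrite (bigID (fun i : 'I_N => (i < j)%N)) /=; congr (_ + _).
  by apply: eq_bigl => i; rewrite -leqNgt.
under eq_bigr => j _ do rewrite split_sum.
rewrite big_split /= big_ord_recl big_pred0 // add0r.
rewrite [X in _ + X]big_ord_recr /= [X in _ + (_ + X)]big_pred0; last first.
  by move=> i; rewrite leqNgt ltn_ord.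
rewrite addr0 [X in _ + X](exchange_big_dep xpredT) //= -big_split big1 // => j _.
rewrite -big_split /= big1 // => i ij.
rewrite /bump leq0n add1n addnS exprS mulN1r scaleNr aS ?ltnS // ?ltn_ord //.
by rewrite addnC addNr.
Qed.

(** * Associative elements of an operad *)

Section AssociativeElement.
Variables (k : fieldType) (Y : nat -> lmodType k) (O : operad Y) (mu : Y 2).

Local Notation i0 := (ord0 : 'I_2).
Local Notation i1 := (ord_max : 'I_2).

(** The two ways of multiplying three inputs agree: [i0] is the left input
    of [mu] and [i1] the right one. *)
Definition associative_elt :=
  op_comp O (erefl : (2 + 2).-1 = 3) i0 mu mu =
  op_comp O (erefl : (2 + 2).-1 = 3) i1 mu mu.

Hypothesis muA : associative_elt.

Lemma associative_eltE p (e : (2 + 2).-1 = p) :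
  op_comp O e i0 mu mu = op_comp O e i1 mu mu.
Proof. by case: p / e. Qed.

(** The left comb on n inputs; 0 is a default in arity 0, where the operad of
    nonunital associative algebras vanishes. *)
Fixpoint comb (n : nat) : Y n :=
  match n with
  | 0 => 0
  | n'.+1 =>
    match n' as n1 return Y n1 -> Y n1.+1 with
    | 0 => fun _ => op_id O
    | n1.+1 => fun f => op_comp O (erefl : (2 + n1.+1).-1 = n1.+2) i0 mu f
    end (comb n')
  end.

Lemma combS n (e : (2 + n.+1).-1 = n.+2) :
  comb n.+2 = op_comp O e i0 mu (comb n.+1).
Proof. by rewrite (eq_irrelevance e erefl). Qed.

Lemma comb2 : comb 2 = mu.
Proof. exact: op_idr. Qed.

Lemma comb_comp0 m n p (e : (m.+1 + n.+1).-1 = p) :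
  op_comp O e ord0 (comb m.+1) (comb n.+1) = comb p.
Proof.
elim: m p e => [|m IHm] p e; first by case: p / e; apply: (op_idl O).
have [q Eq] : exists q, p = q.+2 by exists (m + n)%N; lia.
move: e; rewrite {p}Eq => e.
have e3 : (m.+1 + n.+1).-1 = q.+1 by lia.
rewrite (combS (erefl : (2 + m.+1).-1 = _)).
rewrite (op_seq O (j := ord0) _ _ e3 (erefl : (2 + q.+1).-1 = _)) //.
by rewrite IHm -combS.
Qed.

(** A comb grafted on the right input of [mu] is rotated into a left comb by
    repeated associativity. *)
Lemma comb_mul1 n (e : (2 + n.+1).-1 = n.+2) :
  op_comp O e i1 mu (comb n.+1) = comb n.+2.
Proof.
elim: n e => [|n IHn] e.
  by rewrite comb2; apply: (op_idr O).
have e3 : (2 + n.+1).-1 = n.+2 by [].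
rewrite (combS e3).
rewrite -(op_seq O (h := Ordinal (isT : 1 < 3)%N) (erefl : (2 + 2).-1 = 3) e _ _) //.
rewrite -associative_eltE (op_seq O (j := i1) _ _ e3 e) //.
by rewrite IHn -combS.
Qed.

(** Grafting combs gives a comb.  By induction on the left comb, the only
    new case is grafting at the last input, the right input of the root;
    grafting there before the left subtree makes [comb_mul1] apply. *)
Lemma comb_comp m n p (e : (m.+1 + n.+1).-1 = p) (i : 'I_m.+1) :
  op_comp O e i (comb m.+1) (comb n.+1) = comb p.
Proof.
elim: m p e i => [|m IHm] p e i; first by rewrite (ord1 i) comb_comp0.
have [q Eq] : exists q, p = q.+2 by exists (m + n)%N; lia.
move: e; rewrite {p}Eq => e.
have e1 : (2 + m.+1).-1 = m.+2 by [].
have e4 : (2 + q.+1).-1 = q.+2 by [].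
rewrite (combS e1); have [im|im] := ltnP i m.+1.
  have e3 : (m.+1 + n.+1).-1 = q.+1 by lia.
  rewrite (op_seq O (j := Ordinal im) _ _ e3 e4) //.
  by rewrite IHm -combS.
have e3 : (2 + n.+1).-1 = n.+2 by [].
have e5 : (n.+2 + m.+1).-1 = q.+2 by lia.
rewrite (op_par O (j := i1) (i' := ord0) _ _ e3 e5) //;
  last by move: (ltn_ord i) im => /=; lia.
by rewrite comb_mul1 comb_comp0.
Qed.

(** The sum has one term, or none in arity 0, since the space of operations of
    the associative operad is free on at most one element. *)
Definition comb_mor n (f : as_car k n) : Y n :=
  \sum_(a : as_set n) (f a : k) *: comb n.

Lemma comb_mor_linear n : linear (@comb_mor n).
Proof.
move=> c f g; rewrite /comb_mor scaler_sumr -big_split; apply: eq_bigr => a _ /=.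
by rewrite !ffunE scalerDl scalerA.
Qed.

Lemma comb_mor_delta n (a : as_set n) : comb_mor (delta k a) = comb n.
Proof.
rewrite /comb_mor (bigD1 a) //= big1 => [|b]; last by rewrite (as_set_eq b a) eqxx.
by rewrite ffunE eqxx scale1r addr0.
Qed.

Lemma comb_mor_comp m n p (e : (m + n).-1 = p) i (f : as_car k m) (g : as_car k n) :
  comb_mor (op_comp (as_operad k) e i f g) =
  op_comp O e i (comb_mor f) (comb_mor g).
Proof.
move: f; apply: free_vect_ext => [||a].
- apply: linear_comp; first exact: comb_mor_linear.
  exact: (op_linl (as_operad k)).
- apply: (linear_comp (F := fun x => op_comp O e i x _)); last exact: comb_mor_linear.
  exact: (op_linl O).
move: g; apply: free_vect_ext => [||b].
- apply: linear_comp; first exact: comb_mor_linear.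
  exact: (op_linr (as_operad k)).
- apply: (linear_comp (F := op_comp O e i _)); last exact: comb_mor_linear.
  exact: (op_linr O).
rewrite /= lin_comp_delta !comb_mor_delta.
by case: m n e i a b => [|m] [|n] e i a b; [case: i|case: i|case: b|rewrite comb_comp].
Qed.

Definition associative_multiplication : multiplication O.
Proof.
apply: (@OperadMor _ _ _ (as_operad k) O comb_mor).
- exact: comb_mor_linear.
- exact: (@comb_mor_delta 1).
- exact: comb_mor_comp.
Defined.

Lemma associative_multiplication_mu :
  associative_multiplication 2%N (as_mu k) = mu.
Proof. by rewrite /= comb_mor_delta comb2. Qed.

(** * The differential given by the bracket with an associative element *)

(** The Hochschild cofaces, with a natural number as index so that they can
    be summed and shifted: 0 multiplies [f] on the left by a new first input,
    i.+1 splits the input i of [f], and n.+1 multiplies by a new last input. *)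
Definition coface (n j : nat) (f : Y n) : Y n.+1 :=
  if j is i.+1 then
    if insub i is Some i' then op_comp O (congr1 predn (addn2 n)) i' f mu
    else op_comp O (erefl : (2 + n).-1 = n.+1) i0 mu f
  else op_comp O (erefl : (2 + n).-1 = n.+1) i1 mu f.

Lemma coface0 n (e : (2 + n).-1 = n.+1) f : coface 0 f = op_comp O e i1 mu f.
Proof. by rewrite (eq_irrelevance e erefl). Qed.

Lemma coface_mid n (e : (n + 2).-1 = n.+1) (i : 'I_n) f :
  coface i.+1 f = op_comp O e i f mu.
Proof.
rewrite (eq_irrelevance e (congr1 predn (addn2 n))) /=.
by rewrite valK.
Qed.

Lemma coface_last n (e : (2 + n).-1 = n.+1) f :
  coface n.+1 f = op_comp O e i0 mu f.
Proof.
by rewrite (eq_irrelevance e erefl) /= insubF ?ltnn.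
Qed.

Lemma coface_linear n j : linear (fun f : Y n => coface j f).
Proof.
case: j => [|j] /=; first exact: (op_linr O).
by case: insub => [i|]; [exact: (op_linl O) | exact: (op_linr O)].
Qed.

(** The cosimplicial identities.  They are operad axioms as soon as one of the
    two cofaces splits an input of [f] that the other one leaves alone;
    associativity of [mu] is used when both split the same input of [f] and
    when neither splits an input of [f]. *)
Lemma coface_coface n (f : Y n) i j : (i < j)%N -> (j <= n.+2)%N ->
  coface j (coface i f) = coface i (coface j.-1 f).
Proof.
have e1 : (2 + n).-1 = n.+1 by [].
have e2 : (2 + n.+1).-1 = n.+2 by [].
have e3 : (n + 2).-1 = n.+1 by lia.
have e4 : (n.+1 + 2).-1 = n.+2 by lia.
have e5 : (2 + 2).-1 = 3 by [].
have e6 : (3 + n).-1 = n.+2 by [].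
case: i => [|i]; case: j => // -[|j] ij jn //.
- rewrite (@coface_mid _ e4 ord0) // !(coface0 e1) (coface0 e2).
  rewrite -(op_seq O (h := ord_max) e5 e6 _ _) //.
  rewrite -associative_eltE.
  by rewrite (op_par O (j := i1) (i' := ord0) e5 e6 e1 e4).
- rewrite [j.+2.-1]/= (coface0 e1) (coface0 e2).
  have [jn'|nj] := ltnP j n; last first.
    have {nj jn} -> : j = n by lia.
    rewrite (coface_last e1) // (coface_last e2) //.
    rewrite -(op_seq O (h := Ordinal (isT : 1 < 3)%N) e5 e6 _ _) //.
    rewrite -(op_seq O (h := Ordinal (isT : 1 < 3)%N) e5 e6 _ _) //.
    by rewrite associative_eltE.
  have jS : (j.+1 < n.+1)%N by [].
  rewrite (@coface_mid _ e4 (Ordinal jS)) // (@coface_mid _ e3 (Ordinal jn')) //.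
  by rewrite (op_seq O (j := Ordinal jn') _ _ e3 e2).
rewrite [j.+2.-1]/=.
have [jn'|nj] := ltnP j n; last first.
  have {nj jn} Ej : j = n by lia.
  rewrite Ej (coface_last e1) // (coface_last e2) //.
  have [ni|ni] := ltnP i n.
    have iS : (i < n.+1)%N by lia.
    rewrite (@coface_mid _ e3 (Ordinal ni)) // (@coface_mid _ e4 (Ordinal iS)) //.
    by rewrite (op_seq O (j := Ordinal ni) _ _ e3 e2).
  have {ni} Ei : i = n by lia.
  rewrite Ei (coface_last e1) // (@coface_mid _ e4 ord_max) //.
  rewrite -(op_seq O (h := ord0) e5 e6 _ _) // associative_eltE.
  by rewrite (op_par O (j := i1) (i' := ord0) e1 e4 e5 e6).
have iS : (i < n.+1)%N by lia.
have jS : (j.+1 < n.+1)%N by lia.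
have i_n : (i < n)%N by lia.
rewrite (@coface_mid _ e3 (Ordinal i_n)) // (@coface_mid _ e3 (Ordinal jn')) //.
rewrite (@coface_mid _ e4 (Ordinal iS)) // (@coface_mid _ e4 (Ordinal jS)) //.
have e7 : (n + 3).-1 = n.+2 by lia.
have [ij'|ij'] := ltnP i j.
  by rewrite (op_par O (j := Ordinal jn') (i' := Ordinal iS) e3 e4 e3 e4) //=; lia.
have Eij : Ordinal jn' = Ordinal i_n by apply: val_inj => /=; lia.
rewrite Eij (op_seq O (j := i1) e3 e4 e5 e7) /=; last lia.
rewrite -associative_eltE.
by rewrite (op_seq O (j := i0) e3 e4 e5 e7) //= addn0.
Qed.

(** The suspension signs of the bracket are exactly those of the alternating
    sum, since the degree of [mu] is odd. *)
Lemma bracket_diffE n (f : Y n) :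
  bracket_diff O mu f = - \sum_(j < n.+2) (-1) ^+ j *: coface j f.
Proof.
have sgn a b : odd a = odd b -> (-1) ^+ a = (-1) ^+ b :> k.
  by move=> ab; rewrite -signr_odd ab signr_odd.
have e1 : (2 + n).-1 = n.+1 by [].
have -> : \sum_(j < n.+2) (-1) ^+ j *: coface j f =
    op_comp O e1 i1 mu f +
    (\sum_(i < n) (-1) ^+ i.+1 *: op_comp O (congr1 predn (addn2 n)) i f mu +
     (-1) ^+ n.+1 *: op_comp O e1 i0 mu f).
  rewrite big_ord_recl (coface0 e1) scale1r; congr (_ + _).
  rewrite big_ord_recr -(coface_last e1); congr (_ + _).
  by apply: eq_bigr => i _; rewrite -coface_mid.
rewrite /bracket_diff /bracket (eq_irrelevance (erefl : (2 + n).-1 = n.+1) e1).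
rewrite !opprD -sumrN; set S0 := prelie O _ f mu; set S1 := \sum_(i < n) _.
have <- : S0 = S1.
  apply: eq_bigr => i _; rewrite exprS mulN1r scaleNr opprK.
  by rewrite (sgn (i * 3)%N i) // oddM andbT.
rewrite /prelie big_ord_recl big_ord1 mul0n expr0 scale1r scalerDr opprD scalerA.
have -> : lift ord0 ord0 = i1 by apply: val_inj.
rewrite -exprD (sgn (n.+1 * 3)%N n.+1) ?oddM ?andbT //.
rewrite (sgn (n.+1 * 3 + i1 * n.+1)%N 0%N); last by rewrite mul1n oddD oddM andbT addbb.
by rewrite expr0 scale1r [RHS]addrCA; congr (_ + _); rewrite addrC.
Qed.

Lemma bracket_diff_square n (f : Y n) :
  bracket_diff O mu (bracket_diff O mu f) = 0.
Proof.
have sum0 := @cosimplicial_sum0 _ _ n.+2 (fun j i => coface j (coface i f)).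
rewrite bracket_diffE -sumrN -[RHS]sum0.
  apply: eq_bigr => j _; rewrite bracket_diffE -sumrN.
  under eq_bigr => i _ do rewrite -scaleNr.
  rewrite (lin_sumZ _ _ (@coface_linear _ j)) scaler_sumr -sumrN.
  by apply: eq_bigr => i _; rewrite scalerA -scaleNr mulrN opprK exprD mulrC.
by move=> i j; exact: coface_coface.
Qed.

End AssociativeElement.

(** * Composition in the convolution operad *)

Section ConvolutionOfTensors.
Variables (k : fieldType) (X : nat -> vectType k) (Y : nat -> lmodType k).
Variables (Q : operad X) (E : operad Y).

(** The map [f] is the contraction with the tensor sum_c q_c (x) y_c of
    X n (x) Y n. *)
Definition represents n (I : finType) (f : conv_car X Y n)
    (q : I -> X n) (y : I -> Y n) :=
  forall x : dual (X n), val f x = \sum_c (x (q c) : k) *: y c.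

Lemma sum_dual_vect (U : vectType k) (v : U) :
  \sum_(a < \dim {:U}) (dual_vect a v : k) *: (vbasis {:U})`_a = v.
Proof.
rewrite [RHS](coord_vbasis (memvf v)); apply: eq_bigr => a _.
by rewrite dual_vectE.
Qed.

(** The convolution operad is the Hadamard product of [Q] and [E], tensors
    being composed factor by factor. *)
Lemma conv_comp_tensor m n p (e : (m + n).-1 = p) (i : 'I_m)
    (I J : finType) f g (q : I -> X m) (y : I -> Y m) (q' : J -> X n) (y' : J -> Y n) :
  represents f q y -> represents g q' y' ->
  forall x : dual (X p), val (conv_comp Q E e i f g) x =
    \sum_c \sum_d (x (op_comp Q e i (q c) (q' d)) : k) *:
      op_comp E e i (y c) (y' d).
Proof.
move=> fE gE x; rewrite conv_compE /conv_fun.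
transitivity (\sum_(a < \dim {:X m}) \sum_(b < \dim {:X n}) \sum_c \sum_d
  ((x (op_comp Q e i (vbasis {:X m})`_a (vbasis {:X n})`_b) : k) *
   ((dual_vect a (q c) : k) * (dual_vect b (q' d) : k))) *:
      op_comp E e i (y c) (y' d)).
  apply: eq_bigr => a _; apply: eq_bigr => b _.
  rewrite fE gE op_comp_suml scaler_sumr; apply: eq_bigr => c _.
  rewrite op_comp_sumr !scaler_sumr; apply: eq_bigr => d _.
  by rewrite !scalerA mulrA.
under eq_bigr => a _ do rewrite exchange_big.
rewrite exchange_big; apply: eq_bigr => c _ /=.
under eq_bigr => a _ do rewrite exchange_big.
rewrite exchange_big; apply: eq_bigr => d _ /=.
under eq_bigr => a _ do rewrite -scaler_suml.
rewrite -scaler_suml; congr (_ *: _).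
rewrite -[q c in RHS]sum_dual_vect -[q' d in RHS]sum_dual_vect.
rewrite op_comp_suml linear_sum; apply: eq_bigr => a _.
rewrite op_comp_sumr linearZ linear_sum /= scaler_sumr; apply: eq_bigr => b _.
by rewrite linearZ /GRing.scale /= mulrC mulrA.
Qed.

End ConvolutionOfTensors.

(** * Nondegeneracy of the pairing in arity three *)

Local Notation gen_comp i u v := (@op_comp _ _ (free_operad _) 2 2 3 (erefl 3)
  (i : 'I_2) (free_gen u) (free_gen v)).

Section Pairing.
Variable k : fieldType.

Lemma free_gen_vect (W : vectType k) (a : gen_lab W) :
  free_gen (gen_vect a) = delta k (corolla a).
Proof.
rewrite /free_gen (bigD1 a) //= coord_free ?(basis_free (vbasisP _)) // eqxx scale1r.
rewrite big1 ?addr0 // => b /negbTE nb.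
by rewrite coord_free ?(basis_free (vbasisP _)) // eq_sym nb scale0r.
Qed.

Lemma leaves1 (S : finType) (t : bintree S) : leaves t = 1%N -> t = Leaf S.
Proof.
by case: t => //= a l r; have := leaves_gt0 l; have := leaves_gt0 r; lia.
Qed.

Lemma ntree3P (S : finType) (t : ntree S 3) :
  exists i a b, t = @ngraft S 2 2 3 (erefl 3) i (corolla a) (corolla b).
Proof.
suff [i [a [b Et]]] : exists (i : 'I_2) a b,
    val t = graft (Node a (Leaf S) (Leaf S)) i (Node b (Leaf S) (Leaf S)).
  by exists i, a, b; apply: val_inj; rewrite Et.
move: (eqP (valP t)); case: (val t) => [|a l r] //=.
have l0 := leaves_gt0 l; have r0 := leaves_gt0 r.
case: l l0 => [|b l1 l2] _; case: r r0 => [|c r1 r2] _ //=.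
- have [r10 r20] := (leaves_gt0 r1, leaves_gt0 r2) => h.
  have [/leaves1 -> /leaves1 ->] : leaves r1 = 1%N /\ leaves r2 = 1%N by lia.
  by exists ord_max, a, c.
- have [l10 l20] := (leaves_gt0 l1, leaves_gt0 l2) => h.
  have [/leaves1 -> /leaves1 ->] : leaves l1 = 1%N /\ leaves l2 = 1%N by lia.
  by exists ord0, a, b.
have := (leaves_gt0 l1, leaves_gt0 l2); have := (leaves_gt0 r1, leaves_gt0 r2).
by move=> [? ?] [? ?]; lia.
Qed.

(** F(W)(3) is spanned by the compositions of two generators. *)
Lemma free3_ext (W : vectType k) (U : lmodType k) (F G : free_car W 3 -> U) :
  linear F -> linear G ->
  (forall i u v, F (gen_comp i u v) = G (gen_comp i u v)) ->
  forall x, F x = G x.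
Proof.
move=> linF linG FG; apply: free_vect_ext => // t.
have [i [a [b ->]]] := ntree3P t.
by have := FG i (gen_vect a) (gen_vect b); rewrite !free_gen_vect /= lin_comp_delta.
Qed.

Lemma free_gen_linear (W : vectType k) : linear (@free_gen k W).
Proof.
move=> c u v; rewrite /free_gen scaler_sumr -big_split; apply: eq_bigr => a _ /=.
by rewrite linearP scalerDl scalerA.
Qed.

Lemma gen_comp_sum (W : vectType k) (i : 'I_2) (I J : finType)
    (c : I -> k) (d : J -> k) (u : I -> W) (v : J -> W) :
  gen_comp i (\sum_a c a *: u a) (\sum_b d b *: v b) =
  \sum_a \sum_b (c a * d b) *: gen_comp i (u a) (v b).
Proof.
rewrite !(lin_sumZ _ _ (@free_gen_linear W)) op_comp_suml; apply: eq_bigr => a _.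
rewrite op_comp_sumr scaler_sumr; apply: eq_bigr => b _.
by rewrite scalerA.
Qed.

(** The triple (i, (a, b)) stands for the composition e_a o_i e_b. *)
Definition quad_idx (V : vectType k) : finType :=
  ('I_2 * ('I_(\dim {:V}) * 'I_(\dim {:V})))%type.

Definition quad_triple (V : vectType k) (i : 'I_2)
    (a b : 'I_(\dim {:V})) : quad_idx V :=
  (i, (a, b)).

Definition quad_basis (V : vectType k) (t : quad_idx V) : free_car V 3 :=
  gen_comp t.1 (vbasis {:V})`_t.2.1 (vbasis {:V})`_t.2.2.

Definition quad_dual_basis (V : vectType k) (t : quad_idx V) : free_car (dual V) 3 :=
  gen_comp t.1 (dual_vect t.2.1) (dual_vect t.2.2).

Variable V : vectType k.
Implicit Types (x : free_car V 3) (y : free_car (dual V) 3).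

Lemma sum_quad_idx (W : lmodType k) (F : quad_idx V -> W) :
  \sum_t F t = \sum_i \sum_a \sum_b F (quad_triple i a b).
Proof.
under [RHS]eq_bigr => i _ do
  rewrite (pair_bigA _ (fun a b => F (quad_triple i a b))).
by rewrite pair_bigA; apply: eq_bigr => -[i [a b]].
Qed.

(** The families [quad_basis] and [quad_dual_basis] are dual to each other
    up to the sign (-1)^i of the pairing, so every linear form on F(V)(3) is
    given by the pairing with an explicit element. *)
Lemma pairing_dual_basis (l : free_car V 3 -> k^o) : linear l -> forall x,
  pairing x (\sum_(t : quad_idx V)
    ((-1) ^+ (t.1 : 'I_2) * l (quad_basis t)) *: quad_dual_basis t) = l x.
Proof.
move=> linl; set w := \sum_t _.
apply: (free3_ext (F := fun x => pairing x w : k^o) (G := l)) => // [|j u v].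
  exact: pairing_linl.
have pE (i : 'I_2) a b : ((-1) ^+ i * l (quad_basis (quad_triple i a b))) *
    pairing (gen_comp j u v) (quad_dual_basis (quad_triple i a b)) =
    if j == i then ((dual_vect a u : k) * (dual_vect b v : k)) *
      l (quad_basis (quad_triple i a b)) else 0.
  rewrite pairingE; case: eqP => [->|_]; last by rewrite mulr0.
  by rewrite mulrACA -expr2 sqrr_sign mul1r mulrC.
rewrite /w pairing_sumr [LHS](sum_quad_idx (W := k^o)).
under eq_bigr => i _ do under eq_bigr => a _ do under eq_bigr => b _ do rewrite pE.
rewrite -[u in RHS]sum_dual_vect -[v in RHS]sum_dual_vect gen_comp_sum.
rewrite [X in _ = l X]pair_bigA (lin_sumZ _ _ linl) (bigD1 j) //=.
rewrite [X in _ + X]big1 ?addr0; last first.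
  by move=> i /negbTE ij; rewrite eq_sym ij; do 2![rewrite big1 // => ? _].
by rewrite eqxx pair_bigA.
Qed.

Lemma pairing_basis (l : free_car (dual V) 3 -> k^o) : linear l -> forall y,
  pairing (\sum_(t : quad_idx V)
    ((-1) ^+ (t.1 : 'I_2) * l (quad_dual_basis t)) *: quad_basis t) y = l y.
Proof.
move=> linl; set w := \sum_t _.
apply: (free3_ext (F := fun y => pairing w y : k^o) (G := l)) => // [|j u v].
  exact: pairing_linr.
have pE (i : 'I_2) a b : ((-1) ^+ i * l (quad_dual_basis (quad_triple i a b))) *
    pairing (quad_basis (quad_triple i a b)) (gen_comp j u v) =
    if j == i then ((u (vbasis {:V})`_a : k) * (v (vbasis {:V})`_b : k)) *
      l (quad_dual_basis (quad_triple i a b)) else 0.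
  rewrite pairingE [i == j]eq_sym; case: eqP => _; last by rewrite mulr0.
  by rewrite mulrACA -expr2 sqrr_sign mul1r mulrC.
rewrite /w pairing_suml [LHS](sum_quad_idx (W := k^o)).
under eq_bigr => i _ do under eq_bigr => a _ do under eq_bigr => b _ do rewrite pE.
rewrite [u in RHS]dual_sum [v in RHS]dual_sum gen_comp_sum.
rewrite [X in _ = l X]pair_bigA (lin_sumZ _ _ linl) (bigD1 j) //=.
rewrite [X in _ + X]big1 ?addr0; last first.
  by move=> i /negbTE ij; rewrite eq_sym ij; do 2![rewrite big1 // => ? _].
by rewrite eqxx pair_bigA.
Qed.

(** The orthogonal of the orthogonal of [R] is contained in [R]: each
    coordinate of the projection along [R] onto a complement is a linear form
    that vanishes on [R], hence the pairing with an element of [orth R]. *)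
Lemma orth_orth (R : {vspace free_car V 3}) x :
  (forall y, y \in orth R -> pairing x y = 0) -> x \in R.
Proof.
move=> x_orth.
pose W := (R^C)%VS; pose pr := daddv_pi W R.
have capWR : (W :&: R = 0)%VS by rewrite capvC capv_compl.
suff pr0 : pr x = 0.
  have := @daddv_pi_add _ _ W R x capWR; rewrite -/pr pr0 add0r => <-.
    exact: memv_pi.
  by rewrite addvC addv_complf memvf.
rewrite [pr x](coord_vbasis (memvf _)) big1 // => c _.
pose l z : k^o := coord (vbasis {:free_car V 3}) c (pr z).
have linl : linear l by move=> a z z'; rewrite /l !linearP.
rewrite -[coord _ _ _]/(l x) -(pairing_dual_basis linl) x_orth ?scale0r //.
apply/mem_orth => z zR; rewrite pairing_dual_basis // /l.
have -> : pr z = 0; last by rewrite linear0.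
have z_sum : z \in (W + R)%VS by rewrite addvC addv_complf memvf.
have := daddv_pi_add capWR z_sum; rewrite -/pr [daddv_pi R W z]daddv_pi_id //.
  by move/(canRL (addrK _)); rewrite subrr.
by rewrite capvC.
Qed.

End Pairing.

(** * The twisting cochain is associative *)

Section Alpha.
Variables (k : fieldType) (V : vectType k) (R : {vspace free_car V 3}).
Variables (A : lmodType k) (phi : operad_mor (quad_operad R) (end_operad A)).

Lemma alpha_tensor : represents (alpha phi)
  (fun a : 'I_(\dim {:V}) => quad_gen (orth R) (dual_vect a))
  (fun a => phi 2%N (quad_gen R (vbasis {:V})`_a)).
Proof.
move=> x; rewrite /= /alpha_fun.
have lin_gen : linear (fun v => phi 2%N (quad_gen R v)).
  move=> c u v; rewrite -(mor_linear phi) /quad_gen -linearP.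
  by rewrite free_gen_linear.
by rewrite (lin_sumZ _ _ lin_gen).
Qed.

Lemma alpha_associative : associative_elt (cochain_operad R A) (alpha phi).
Proof.
apply: linmap_eq => x; pose e3 : (2 + 2).-1 = 3 := erefl.
(* [l] is [x] as a linear form on F(V^dual)(3) vanishing on orth R, and [w i]
   the part of its contraction with the canonical element supported by the
   compositions at the input [i]. *)
pose l y : k^o := x (quot_proj (free_operad (dual V)) (orth R) y).
have linl : linear l by move=> c y z; rewrite /l !linearP.
pose w (i : 'I_2) := \sum_a \sum_b
  l (quad_dual_basis (quad_triple i a b)) *: quad_basis (quad_triple i a b).
have compE i : val (op_comp (cochain_operad R A) e3 i (alpha phi) (alpha phi)) x =
    phi 3%N (quot_proj (free_operad V) R (w i)).
  rewrite [LHS](conv_comp_tensor _ _ _ _ alpha_tensor alpha_tensor).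
  have linphi : linear (fun z => phi 3%N (quot_proj (free_operad V) R z)).
    by move=> c y z; rewrite linearP (mor_linear phi).
  rewrite /w !pair_bigA (lin_sumZ _ _ linphi); apply: eq_bigr => -[a b] _ /=.
  congr (_ *: _).
    by rewrite /l /quad_dual_basis -(quot_proj_comp (free_operad (dual V)) (orth R) e3).
  rewrite -[LHS](mor_comp phi e3); congr (phi _ _).
  exact: (quot_proj_comp (free_operad V) R e3).
rewrite !compE; congr (phi _ _); apply/eqP; rewrite -subr_eq0 -linearB.
rewrite quot_proj_eq0; apply/mem_ideal => D _; apply; apply: orth_orth => y yR.
have -> : w ord0 - w ord_max =
    \sum_(t : quad_idx V)
      ((-1) ^+ (t.1 : 'I_2) * l (quad_dual_basis t)) *: quad_basis t.
  rewrite [RHS](sum_quad_idx (W := free_car V 3)) big_ord_recl big_ord1; congr (_ + _).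
    by do 2![apply: eq_bigr => ? _]; rewrite mul1r.
  have -> : lift ord0 ord0 = ord_max :> 'I_2 by apply: val_inj.
  rewrite -sumrN; apply: eq_bigr => a _; rewrite -sumrN; apply: eq_bigr => b _.
  by rewrite expr1 mulN1r scaleNr.
rewrite pairing_basis // /l.
have -> : quot_proj (free_operad (dual V)) (orth R) y = 0; last by rewrite linear0.
by apply/eqP; rewrite quot_proj_eq0; apply/mem_ideal => D' _; apply.
Qed.

End Alpha.

Theorem proposition42 (k : fieldType) (char0 : [pchar k] =i pred0)
    (V : vectType k) (R : {vspace free_car V 3})
    (koszulP : binary_koszul (quad_operad R))
    (A : lmodType k) (phi : operad_mor (quad_operad R) (end_operad A)) :
  (forall n (f : cochain R A n), cohom_diff phi (cohom_diff phi f) = 0) /\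
  exists M : multiplication (cochain_operad R A),
    forall n (f : cochain R A n), cohom_diff phi f = mult_diff M f.
Proof.
have muA := alpha_associative phi.
split=> [n f|]; first exact: bracket_diff_square muA _ _.
exists (associative_multiplication muA) => n f.
by rewrite /mult_diff associative_multiplication_mu.
Qed.
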